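(* Let $T>0$ and let $\overline u(x,t)$ and $\underline u(x,t)$ be a supersolution and a subsolution of problem (P) (defined in the context) in $Q_T$, respectively. If either $\min(q,l)<1$ or $0<p<1$, suppose in addition that $\underline u(x,t)>0$ in $Q_T\cup\Gamma_T$ or $\overline u(x,t)>0$ in $Q_T\cup\Gamma_T$. Then $\overline u(x,t)\ge\underline u(x,t)$ in $Q_T\cup\Gamma_T$.
   Context: Let $n\ge 1$, let $\Omega\subset\mathbb{R}^n$ be a bounded domain with smooth boundary $\partial\Omega$, and let $\nu$ be the unit outward normal on $\partial\Omega$. Let $p\ge 0$, $q>0$, $m>0$, $l>0$, $a>0$, $b>0$ be constants (for $p=0$, $u^p$ is understood as $1$). Let $k\in C(\partial\Omega\times\overline\Omega\times[0,+\infty))$ with $k(x,y,t)\ge 0$, and let $u_0\in C^1(\overline\Omega)$ satisfy $u_0(x)\ge 0$ in $\Omega$ and $\frac{\partial u_0(x)}{\partial\nu}=\int_\Omega k(x,y,0)u_0^l(y)\,dy$ on $\partial\Omega$. For $T>0$ put $Q_T=\Omega\times(0,T)$, $S_T=\partial\Omega\times(0,T)$, $\Gamma_T=S_T\cup(\overline\Omega\times\{0\})$. Problem (P): $$u_t=\Delta u+a u^p\int_0^t u^q(x,\tau)\,d\tau-bu^m,\quad x\in\Omega,\ t>0,$$ $$\frac{\partial u(x,t)}{\partial\nu}=\int_\Omega k(x,y,t)u^l(y,t)\,dy,\quad x\in\partial\Omega,\ t>0,$$ $$u(x,0)=u_0(x),\quad x\in\Omega.$$ A nonnegative function $u\in C^{2,1}(Q_T)\cap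 C^{1,0}(Q_T\cup\Gamma_T)$ is a supersolution of (P) in $Q_T$ if $u_t\ge\Delta u+au^p\int_0^t u^q(x,\tau)\,d\tau-bu^m$ for $(x,t)\in Q_T$, $\frac{\partial u(x,t)}{\partial\nu}\ge\int_\Omega k(x,y,t)u^l(y,t)\,dy$ for $(x,t)\in S_T$, and $u(x,0)\ge u_0(x)$ for $x\in\Omega$. It is a subsolution of (P) in $Q_T$ if it is nonnegative, of the same regularity, and satisfies these three inequalities in the reverse order. *)

(* Defs.v *)
From HB Require Import structures.
From mathcomp Require Import all_boot all_order all_algebra.
From mathcomp Require Import all_classical all_reals all_analysis.
Import numFieldNormedType.Exports.
Import Order.TTheory GRing.Theory Num.Theory.

Set Implicit Arguments.
Unset Strict Implicit.
Unset Printing Implicit Defensive.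

Local Open Scope classical_set_scope.
Local Open Scope ring_scope.

Definition measure_rV_display : measure_display -> measure_display.
Proof. exact. Qed.

(* The product sigma-algebra on row vectors, generated by the coordinates as
   the one the library puts on tuples; for real entries it is the Borel one. *)
Section measurable_rV.
Context {d} {T : measurableType d} (n : nat).

Let coord : 'I_n -> 'rV[T]_n -> T := fun i v => v ord0 i.

Let rV_set0 : g_sigma_preimage coord set0.
Proof. exact: sigma_algebra0. Qed.

Let rV_setC A : g_sigma_preimage coord A -> g_sigma_preimage coord (~` A).
Proof. exact: sigma_algebraC. Qed.

Let rV_bigcup (F : _^nat) : (forall i, g_sigma_preimage coord (F i)) ->
  g_sigma_preimage coord (\bigcup_i (F i)).
Proof. exact: sigma_algebra_bigcup. Qed.

HB.instance Definition _ := @isMeasurable.Build (measure_rV_display d)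
  'rV[T]_n (g_sigma_preimage coord) rV_set0 rV_setC rV_bigcup.

Lemma measurable_coord (i : 'I_n) :
  measurable_fun [set: 'rV[T]_n] (fun v => v ord0 i).
Proof.
move=> _ Y mY; rewrite setTI; apply: sub_sigma_algebra => /=.
rewrite -bigcup_seq/=; exists i => /=; first by rewrite mem_index_enum.
by exists Y => //; rewrite setTI.
Qed.

Lemma measurable_fun_coordP d1 (T1 : measurableType d1) (f : T1 -> 'rV[T]_n) :
  (forall i, measurable_fun [set: T1] (fun x => f x ord0 i)) ->
  measurable_fun [set: T1] f.
Proof.
move=> mf; have /= sub : g_sigma_preimage (fun i => coord i \o f) `<=` measurable.
  apply: smallest_sub; first exact: sigma_algebra_measurable.
  rewrite -bigcup_seq; apply: bigcup_sub => i _ A [B mB <-]; exact: mf.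
move=> _ A mA; rewrite setTI; apply: sub.
rewrite g_sigma_preimage_comp; exists A => //; by rewrite setTI.
Qed.

End measurable_rV.

Section lebesgue_rV.
Context {R : realType}.
Local Open Scope ereal_scope.
Local Notation rV n := 'rV[measurableTypeR R]_n.

Definition cons_rV n (z : measurableTypeR R * rV n) : rV n.+1 :=
  row_mx (\row__ z.1) z.2 : rV (1 + n).

Lemma cons_rV0 n (z : measurableTypeR R * rV n) : cons_rV z ord0 ord0 = z.1.
Proof.
rewrite /cons_rV (_ : ord0 = lshift n ord0 :> 'I_(1 + n)); last exact: val_inj.
by rewrite [LHS]row_mxEl mxE.
Qed.

Lemma cons_rVS n (z : measurableTypeR R * rV n) (i : 'I_n) :
  cons_rV z ord0 (lift ord0 i) = z.2 ord0 i.
Proof.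
by rewrite -rshift1 [LHS]row_mxEr.
Qed.

Lemma measurable_cons_rV n : measurable_fun setT (@cons_rV n).
Proof.
apply: measurable_fun_coordP => i.
case: (unliftP ord0 i) => [j ->|->].
  rewrite (_ : (fun z => _) = (fun v : rV n => v ord0 j) \o snd).
    exact: (measurableT_comp (@measurable_coord _ _ n j)).
  by apply/funext => z /=; rewrite cons_rVS.
rewrite (_ : (fun z => _) = fst); first exact: measurable_fst.
by apply/funext => z; rewrite cons_rV0.
Qed.

Section lebesgue_rV_step.
Variables (n : nat) (mu : {sigma_finite_measure set (rV n) -> \bar R}).

Definition lebesgue_rV_step : set (rV n.+1) -> \bar R :=
  pushforward (@lebesgue_measure R \x mu) (@cons_rV n).

Let step0 : lebesgue_rV_step set0 = 0.
Proof. by rewrite /lebesgue_rV_step /pushforward preimage_set0 measure0. Qed.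

Let step_ge0 A : 0 <= lebesgue_rV_step A.
Proof. by rewrite /lebesgue_rV_step /pushforward measure_ge0. Qed.

Let step_sigma_additive : semi_sigma_additive lebesgue_rV_step.
Proof.
have mcons A : measurable A -> measurable (@cons_rV n @^-1` A).
  by move=> mA; rewrite -[X in measurable X]setTI; exact: measurable_cons_rV.
move=> F mF tF mUF; rewrite /lebesgue_rV_step /pushforward preimage_bigcup.
apply: measure_semi_sigma_additive.
- by move=> k; exact: mcons.
- apply/trivIsetP => i j _ _ ij; rewrite -preimage_setI.
  by move/trivIsetP : tF => /(_ _ _ I I ij) ->; rewrite preimage_set0.
- by rewrite -preimage_bigcup; exact: mcons.
Qed.

HB.instance Definition _ := isMeasure.Build _ _ _ lebesgue_rV_step
  step0 step_ge0 step_sigma_additive.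

Lemma lebesgue_rV_stepE (A : set R) (B : set (rV n)) (C : set (rV n.+1)) :
  measurable (A : set (measurableTypeR R)) -> measurable B ->
  (forall z, C (cons_rV z) <-> A z.1 /\ B z.2) ->
  lebesgue_rV_step C = lebesgue_measure A * mu B.
Proof.
move=> mA mB CAB; rewrite -product_measure1E//; congr (product_measure1 _ _ _).
by apply/seteqP; split => z /CAB.
Qed.

Lemma lebesgue_rV_step_sigma_finite : sigma_finite setT lebesgue_rV_step.
Proof.
have /sigma_finiteP[F [TF ndF Foo]] := sigma_finiteT (@lebesgue_measure R).
have /sigma_finiteP[G [TG ndG Goo]] := sigma_finiteT mu.
pose H k := [set v : rV n.+1 |
  F k (v ord0 ord0) /\ G k (\row_i v ord0 (lift ord0 i))].
have HE k z : H k (cons_rV z) <-> F k z.1 /\ G k z.2.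
  rewrite /H/= cons_rV0 (_ : \row_i _ = z.2)//.
  by apply/rowP => i; rewrite mxE cons_rVS.
have mbehead : measurable_fun setT
    (fun v : rV n.+1 => \row_i v ord0 (lift ord0 i) : rV n).
  apply: measurable_fun_coordP => i.
  rewrite (_ : (fun v => _) = fun v : rV n.+1 => v ord0 (lift ord0 i)).
    exact: (@measurable_coord _ _ n.+1).
  by apply/funext => v; rewrite mxE.
exists H => [|k].
  apply/esym; rewrite -subTset => v _.
  have : setT (v ord0 ord0) by []. rewrite TF => -[i _ Fi].
  have : setT (\row_i v ord0 (lift ord0 i) : rV n) by []. rewrite TG => -[j _ Gj].
  exists (maxn i j) => //; split.
    by move: Fi; exact/subsetPset/ndF/leq_maxl.
  by move: Gj; exact/subsetPset/ndG/leq_maxr.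
have [mF Fk] := Foo k; have [mG Gk] := Goo k; split.
  apply: measurableI; rewrite -[X in measurable X]setTI.
    exact: (@measurable_coord _ _ _ ord0).
  exact: mbehead.
by rewrite (lebesgue_rV_stepE mF mG (HE k)) lte_mul_pinfty// ge0_fin_numE.
Qed.

HB.instance Definition _ := Measure_isSigmaFinite.Build _ _ _ lebesgue_rV_step
  lebesgue_rV_step_sigma_finite.

End lebesgue_rV_step.

(* The n-dimensional Lebesgue measure on the Borel sets of R^n, as the n-fold
   product of [lebesgue_measure]; [lebesgue_rV_box] gives its value on boxes. *)
Fixpoint lebesgue_rV n : {sigma_finite_measure set (rV n) -> \bar R} :=
  match n return {sigma_finite_measure set (rV n) -> \bar R} with
  | 0 => @dirac _ (rV 0) (0%R : 'rV[R]_0) R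
  | m.+1 => lebesgue_rV_step (lebesgue_rV m)
  end.

Lemma lebesgue_rV_box n (A : 'I_n -> set R) :
  (forall i, measurable (A i : set (measurableTypeR R))) ->
  lebesgue_rV n [set v | forall i, A i (v ord0 i)] =
  \prod_(i < n) lebesgue_measure (A i).
Proof.
elim: n A => [|n IHn] A mA.
  by rewrite big_ord0 /= diracE mem_set// => -[].
rewrite big_ord_recl -IHn => [|i]; last exact: mA.
apply: lebesgue_rV_stepE => // [|z].
- rewrite [X in measurable X](_ : _ =
    \bigcap_(i in [set: 'I_n]) ((fun v : rV n => v ord0 i) @^-1` A (lift ord0 i))).
    apply: fin_bigcap_measurable => //.
    move=> i _; rewrite -[X in measurable X]setTI.
    exact: (@measurable_coord _ _ n).
  by apply/seteqP; split => [v vA i _|v vA i]; apply: vA.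
- split=> [Az|[Az0 AzS] i].
    by split=> [|i]; [move: (Az ord0)|move: (Az (lift ord0 i))];
      rewrite ?cons_rV0 ?cons_rVS.
  by case: (unliftP ord0 i) => [j ->|->]; rewrite ?cons_rV0 ?cons_rVS.
Qed.

End lebesgue_rV.
Arguments lebesgue_rV {R} n.

Section smooth_domains.
Context {R : realType} (n : nat).
Implicit Types (Omega U : set 'rV[R]_n) (f phi : 'rV[R]_n -> R).

Definition partial (i : 'I_n) f : 'rV[R]_n -> R := 'D_(delta_mx 0 i) f.

Definition grad f (x : 'rV[R]_n) : 'rV[R]_n := \row_i partial i f x.

Definition laplacian f (x : 'rV[R]_n) : R := \sum_i partial i (partial i f) x.

(* The library's norm on ['rV[R]_n] is the sup norm; it induces the usual
   topology but cannot be used to normalize vectors. *)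
Definition euclidean_norm (v : 'rV[R]_n) : R := Num.sqrt (\sum_i v 0 i ^+ 2).

Definition bdry Omega : set 'rV[R]_n := closure Omega `\` Omega°.

(* For [U] open. *)
Fixpoint Ck (k : nat) U f : Prop :=
  match k with
  | 0 => {within U, continuous f}
  | k.+1 => {within U, continuous f} /\
      forall i, (forall x, U x -> derivable f x (delta_mx 0 i)) /\
        Ck k U (partial i f)
  end.

Definition smooth_on U f : Prop := forall k, Ck k U f.

(* Around [x], [phi] is a smooth defining function of [Omega], negative inside. *)
Definition defining_function Omega (x : 'rV[R]_n) U phi : Prop :=
  [/\ open U /\ U x, smooth_on U phi,
      forall y, U y -> (Omega y <-> phi y < 0),
      forall y, U y -> (bdry Omega y <-> phi y = 0)
    & forall y, U y -> grad phi y != 0].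

Definition smooth_boundary Omega : Prop :=
  forall x, bdry Omega x -> exists U phi, defining_function Omega x U phi.

Definition domain Omega : Prop := [/\ open Omega, connected Omega & Omega !=set0].

Definition is_outward_unit_normal Omega (x v : 'rV[R]_n) : Prop :=
  exists U phi, defining_function Omega x U phi /\
    v = (euclidean_norm (grad phi x))^-1 *: grad phi x.

(* One-sided difference quotient, so that only values of [f] on the closed
   domain are involved; for [f] of class C^1 up to the boundary the limit exists
   and is the scalar product of [v] with the boundary value of the gradient. *)
Definition normal_derivative (v : 'rV[R]_n) f (x : 'rV[R]_n) : R :=
  lim ((f x - f (x - h *: v)) / h @[h --> 0^'+]).

(* The partial derivatives exist in the open set [Omega] and extend
   continuously to its closure. *)
Definition C1_closure Omega f : Prop :=
  {within closure Omega, continuous f} /\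
  forall i, (forall x, Omega x -> derivable f x (delta_mx 0 i)) /\
    exists2 g : 'rV[R]_n -> R, {within closure Omega, continuous g} &
      forall x, Omega x -> g x = partial i f x.

End smooth_domains.

Section problem.
Context {R : realType} (n : nat).
Variables (Omega : set 'rV[R]_n) (T : R).
Implicit Types u : 'rV[R]_n -> R -> R.

Definition QT : set ('rV[R]_n * R) := Omega `*` `]0, T[.

Definition ST : set ('rV[R]_n * R) := bdry Omega `*` `]0, T[.

Definition GammaT : set ('rV[R]_n * R) := ST `|` closure Omega `*` [set 0].

Definition C21 u : Prop :=
  [/\ {within QT, continuous (fun z => u z.1 z.2)},
      (forall x t, QT (x, t) -> derivable (u x) t 1) /\
        {within QT, continuous (fun z => derive1 (u z.1) z.2)},
      forall i, (forall x t, QT (x, t) -> derivable (u ^~ t) x (delta_mx 0 i)) /\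
        {within QT, continuous (fun z => partial i (u ^~ z.2) z.1)}
    & forall i j,
        (forall x t, QT (x, t) ->
          derivable (partial i (u ^~ t)) x (delta_mx 0 j)) /\
        {within QT,
          continuous (fun z => partial j (partial i (u ^~ z.2)) z.1)}].

(* The spatial derivatives, which make sense classically in Omega x [0, T[,
   extend continuously to the lateral boundary. *)
Definition C10 u : Prop :=
  {within QT `|` GammaT, continuous (fun z => u z.1 z.2)} /\
  forall i,
    (forall x t, Omega x -> 0 <= t < T -> derivable (u ^~ t) x (delta_mx 0 i)) /\
    exists2 g : 'rV[R]_n * R -> R, {within QT `|` GammaT, continuous g} &
      forall x t, Omega x -> 0 <= t < T -> g (x, t) = partial i (u ^~ t) x.

Variables (nu : 'rV[R]_n -> 'rV[R]_n) (p q m l a b : R).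
Variables (k : 'rV[R]_n -> 'rV[R]_n -> R -> R) (u0 : 'rV[R]_n -> R).

(* [x `^ 0 = 1] for every [x], including [x = 0], as required when [p = 0]. *)
Definition rhs u (x : 'rV[R]_n) (t : R) : R :=
  laplacian (u ^~ t) x
  + a * u x t `^ p * (\int[lebesgue_measure]_(s in `[0, t]) (u x s `^ q))
  - b * u x t `^ m.

Definition boundary_flux (w : 'rV[R]_n -> R) (x : 'rV[R]_n) (t : R) : R :=
  \int[lebesgue_rV n]_(y in Omega) (k x y t * w y `^ l).

Definition supersolution u : Prop :=
  [/\ forall x t, (QT `|` GammaT) (x, t) -> 0 <= u x t, C21 u /\ C10 u,
      forall x t, QT (x, t) -> derive1 (u x) t >= rhs u x t,
      forall x t, ST (x, t) ->
        normal_derivative (nu x) (u ^~ t) x >= boundary_flux (u ^~ t) x t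
    & forall x, Omega x -> u x 0 >= u0 x].

Definition subsolution u : Prop :=
  [/\ forall x t, (QT `|` GammaT) (x, t) -> 0 <= u x t, C21 u /\ C10 u,
      forall x t, QT (x, t) -> derive1 (u x) t <= rhs u x t,
      forall x t, ST (x, t) ->
        normal_derivative (nu x) (u ^~ t) x <= boundary_flux (u ^~ t) x t
    & forall x, Omega x -> u x 0 <= u0 x].

End problem.

(* Main.v *)
(* Let w = uunder - uover and suppose w > 0 somewhere on closure Omega x [0, t1].
   Take a barrier phi, bounded between two positive constants, with Laplacian
   bounded above and with outward normal derivative at least B on the boundary, and
   maximize w / (exp (lam t) phi).  If the maximum mu > 0 is reached at (x0, t0),
   then w <= mu exp (lam t) phi everywhere, with equality at (x0, t0), and t0 > 0.
   If x0 is interior, comparing derivatives at (x0, t0) bounds lam, the memory term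
   being controlled by w(x0, s) <= mu exp (lam s) phi(x0) <= w(x0, t0) for s <= t0;
   if x0 is on the boundary, the flux inequality bounds B.  Both are impossible for
   B, then lam, large enough.

   Apart from the absorption term, which only needs monotonicity, the powers enter
   through uunder^r - uover^r <= C D whenever w <= D and D >= 0.  This one-sided
   Lipschitz bound is elementary for r = 0 or r >= 1, and follows from the
   positivity assumption for r in (0, 1).

   The barrier is a minimum of finitely many functions 1 + exp (M rho) + A |x - z|^2,
   with rho a local defining function near a boundary point z, and of the constant
   5/2.  A minimum suffices, since at the maximum point w is then also touched from
   above by one of the smooth functions. *)
Require Import Defs.
From mathcomp Require Import all_boot all_order all_algebra.
From mathcomp Require Import finmap.
From mathcomp Require Import all_classical all_reals all_analysis.
From mathcomp Require Import measurable_realfun ring lra.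
Import numFieldNormedType.Exports.
Import Order.TTheory GRing.Theory Num.Theory.
Local Open Scope classical_set_scope.
Local Open Scope ring_scope.
Set Implicit Arguments.
Unset Strict Implicit.
Unset Printing Implicit Defensive.

(** * Directional derivatives *)

(** Multiplying the difference quotient by h yields a first-order expansion that also covers h = 0,
    so that neither a division nor a punctured neighbourhood remains. *)
Lemma is_deriveP (R : realType) (V : normedModType R) (f : V -> R) (x v : V)
    (d : R) :
  is_derive x v f d <-> forall e, 0 < e ->
    \forall h \near (0 : R), `|f (x + h *: v) - f x - h * d| <= e * `|h|.
Proof.
split=> [[df <-] e e0|fd].
  have /cvgr_dist_le/(_ e e0) : h^-1 *: (f (h *: v + x) - f x) @[h --> 0^'] -->
    'D_v f x by exact: df.
  rewrite near_withinE; apply: filterS => h /= dh.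
  have [->|h0] := eqVneq h 0.
    by rewrite scale0r addr0 mul0r subr0 subrr normr0 mulr0.
  have {dh} := dh h0; rewrite distrC -(@ler_pM2r _ `|h|) ?normr_gt0// -normrM.
  rewrite /GRing.scale/= mulrBl mulrAC mulVf// mul1r addrC (addrC x).
  by rewrite (mulrC h) (addrC _ (- (_ * h))).
have dcvg : h^-1 *: (f (h *: v + x) - f x) @[h --> 0^'] --> d.
  apply/cvgrPdist_le => e e0; rewrite near_withinE.
  apply: filterS (fd e e0) => h /= dh h0.
  rewrite distrC -(@ler_pM2r _ `|h|) ?normr_gt0// -normrM.
  rewrite /GRing.scale/= mulrBl mulrAC mulVf// mul1r.
  by rewrite (mulrC d) (addrC _ x).
by split; [apply/cvg_ex; exists d|exact: cvg_lim].
Qed.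

Lemma is_derive_line (R : realType) (V : normedModType R) (f : V -> R)
    (x v : V) (s d : R) :
  is_derive (x + s *: v) v f d -> is_derive s 1 (fun r => f (x + r *: v)) d.
Proof.
move=> /is_deriveP fd; apply/is_deriveP => e /fd; apply: filterS => h.
by rewrite [h *: 1]mulr1 scalerDl addrA.
Qed.

(** Only earlier times are compared, because the maximum in time may sit at the final time. If d <
    0, the expansion with error -d / 2 makes h larger just before t. *)
Lemma derive_ge0_left_max (R : realType) (h : R -> R) (t d : R) :
  is_derive t 1 h d -> (\forall s \near t, s < t -> h s <= h t) -> 0 <= d.
Proof.
move=> /is_deriveP hd hmax; rewrite leNgt; apply/negP => d0.
have e0 : 0 < - d / 2 by lra.
have /nbhs_ballP[r/= r0 hr] := hd _ e0.
have /nbhs_ballP[q/= q0 hq] := hmax.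
pose e := Num.min r q / 2.
have e_gt0 : 0 < e by rewrite divr_gt0// lt_min r0.
have er : e < r /\ e < q.
  have : Num.min r q <= r /\ Num.min r q <= q by rewrite !ge_min !lexx orbT.
  by move: e_gt0; rewrite /e; lra.
have := hr (- e); have := hq (t - e).
rewrite -!ball_normE /= opprB addrC subrK opprK add0r gtr0_norm// normrN.
rewrite (gtr0_norm e_gt0) => /(_ er.2) ht /(_ er.1).
rewrite /GRing.scale /= mulr1 ler_norml; have := ht (ltac:(lra)); nra.
Qed.

(** The first derivative vanishes at the maximum 0. If d > 0, it would be positive just to the right
    of 0, and the mean value theorem would give h s > h 0. *)
Lemma second_derive_le0_at_max (R : realType) (h : R -> R) (d : R) :
  (\forall s \near (0 : R), derivable h s 1) -> is_derive (0 : R) 1 (derive1 h) d ->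
  (\forall s \near (0 : R), h s <= h 0) -> d <= 0.
Proof.
move=> /nbhs_ballP[r/= r0 hr] hd /nbhs_ballP[q/= q0 hq].
rewrite leNgt; apply/negP => d0.
pose e := Num.min r q / 2.
have e_gt0 : 0 < e by rewrite divr_gt0// lt_min r0.
have er : e < r /\ e < q.
  have : Num.min r q <= r /\ Num.min r q <= q by rewrite !ge_min !lexx orbT.
  by move: e_gt0; rewrite /e; lra.
have b_er s : -e < s < e -> ball (0 : R) r s /\ ball (0 : R) q s.
  by move=> se; rewrite -!ball_normE /= !add0r !normrN !ltr_norml; split; lra.
have h0 : derive1 h 0 = 0.
  rewrite derive1E; apply: derive_val.
  apply: (@derive1_at_max _ h (- e) e 0); first lra.
  - by move=> t; rewrite in_itv/= => /b_er[/hr].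
  - by rewrite in_itv /=; lra.
  - by move=> t; rewrite in_itv/= => /b_er[_ /hq].
have /is_deriveP/(_ (d / 2) (ltac:(lra)))/nbhs_ballP[k/= k0 hk] := hd.
pose s := Num.min e k / 2.
have [s_gt0 [se sk]] : 0 < s /\ s < e /\ s < k.
  have : 0 < Num.min e k by rewrite lt_min e_gt0.
  have : Num.min e k <= e /\ Num.min e k <= k by rewrite !ge_min !lexx orbT.
  by rewrite /s; lra.
have := @MVT _ h (derive1 h) 0 s s_gt0 _ _.
have dh y : y \in `]0, s[ -> is_derive y 1 h (derive1 h y).
  rewrite in_itv/= => ys; rewrite derive1E; apply: derivableP; apply: hr.
  by apply: (b_er y _).1; lra.
case=> //.
  apply: derivable_within_continuous => y; rewrite in_itv/= => ys.
  by apply: hr; apply: (b_er y _).1; lra.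
move=> c; rewrite in_itv/= => cs.
have := hk c; rewrite -ball_normE /= !add0r normrN ltr_norml h0.
rewrite /GRing.scale/= mulr1 ler_norml !subr0 (gtr0_norm (_ : 0 < c)); last lra.
move=> /(_ (ltac:(lra))) h1 h2.
have : h s <= h 0 by apply: hq; apply: (b_er s _).2; lra.
have : 0 < derive1 h c * (s - 0).
  by apply: mulr_gt0; [have := mulr_gt0 d0 (_ : 0 < c)|]; lra.
lra.
Qed.

(** A mean value theorem that does not depend on the sign of b, for the increment h * c in
    [is_deriveDr]. *)
Lemma MVT_norm_le (R : realType) (f df : R -> R) (b : R) :
  (forall s : R, `|s| <= `|b| -> is_derive s 1 f (df s)) ->
  exists2 c, `|c| <= `|b| & f b - f 0 = df c * b.
Proof.
move=> fd; have fc a' b' : -`|b| <= a' -> b' <= `|b| ->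
    {within `[a', b'], continuous f}.
  move=> ba bb; apply: derivable_within_continuous => y; rewrite in_itv/= => ys.
  by have [] := fd y (ltac:(rewrite ler_norml; lra)).
have [b0|b0|->] := ltgtP b 0; last by exists 0; rewrite ?normr0// subrr mulr0.
- have bE : `|b| = - b by rewrite ltr0_norm.
  have [y||c] := @MVT _ f df b 0 b0.
  + rewrite in_itv/= => ys; apply: fd; rewrite ler_norml; lra.
  + by apply: fc; lra.
  + rewrite in_itv/= => cs fE; exists c; first by rewrite ler_norml; lra.
    by rewrite -opprB fE sub0r mulrN opprK.
- have bE : `|b| = b by rewrite gtr0_norm.
  have [y||c] := @MVT _ f df 0 b b0.
  + rewrite in_itv/= => ys; apply: fd; rewrite ler_norml; lra.
  + by apply: fc; lra.
  + rewrite in_itv/= => cs fE; exists c; first by rewrite ler_norml; lra.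
    by rewrite fE subr0.
Qed.

(** The increment is split into a leg h w, handled by the derivative along w, and a leg h c e. On
    the second leg the mean value theorem gives 'D_e f at an intermediate point, and continuity
    brings it back to x. *)
Lemma is_deriveDr (R : realType) (V : normedModType R) (f : V -> R)
    (x w e : V) (c d : R) :
  is_derive x w f d -> (\forall y \near x, derivable f y e) ->
  {for x, continuous ('D_e f)} ->
  is_derive x (w + c *: e) f (d + c * 'D_e f x).
Proof.
move=> /is_deriveP fd fe De; apply/is_deriveP => eps eps0.
(* This gives eta |c| <= eps / 2, also when c = 0. *)
pose eta := eps / 2 / (`|c| + 1).
have c1 : 0 < `|c| + 1 by rewrite ltr_wpDl.
have eta0 : 0 < eta by rewrite !divr_gt0.
have De' : \forall y \near x, `|'D_e f y - 'D_e f x| <= eta.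
  by move/cvgr_dist_le : De => /(_ _ eta0); apply: filterS => y; rewrite distrC.
have /nbhs_ballP[r/= r0 hr] : \forall y \near x, derivable f y e /\
  `|'D_e f y - 'D_e f x| <= eta by near=> y; split; near: y.
(* Both legs stay within |h| C of x, hence in the ball of radius r once |h| < r / C. *)
pose C := `|w| + `|c| * `|e| + 1.
have C0 : 0 < C by rewrite ltr_wpDl// addr_ge0// mulr_ge0.
have hC : \forall h \near (0 : R), `|h| < r / C.
  apply/nbhs_ballP; exists (r / C) => /=; first by rewrite divr_gt0.
  by move=> h; rewrite -ball_normE /= add0r normrN.
have eps2 : 0 < eps / 2 by rewrite divr_gt0.
near=> h.
have hrC : `|h| < r / C by near: h.
have hw : `|f (x + h *: w) - f x - h * d| <= eps / 2 * `|h|.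
  by near: h; exact: fd.
have inb s : `|s| <= `|h * c| -> ball x r (x + h *: w + s *: e).
  rewrite normrM => sc; rewrite -ball_normE /= -addrA opprD addNKr normrN.
  apply: le_lt_trans (ler_normD _ _) _; rewrite !normrZ.
  have : `|h| * C < r by rewrite -ltr_pdivlMr.
  have : `|s| * `|e| <= `|h| * `|c| * `|e| by rewrite ler_wpM2r.
  have := normr_ge0 h; rewrite /C; set A := `|h|; set B := `|w|; nra.
have [|s sc] := @MVT_norm_le _ (fun s => f (x + h *: w + s *: e))
    (fun s => 'D_e f (x + h *: w + s *: e)) (h * c).
  by move=> s /inb/hr[? _]; apply: is_derive_line; exact: derivableP.
rewrite scale0r addr0 => fE.
have Ds := (hr _ (inb _ sc)).2.
have -> : f (x + h *: (w + c *: e)) - f x - h * (d + c * 'D_e f x) =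
  (f (x + h *: w) - f x - h * d) +
  ('D_e f (x + h *: w + s *: e) - 'D_e f x) * (h * c).
  rewrite mulrBl -fE scalerDr scalerA addrA; ring.
apply: le_trans (ler_normD _ _) _; rewrite [leRHS](_ : _ =
  eps / 2 * `|h| + eps / 2 * `|h|); last by field.
rewrite lerD// normrM normrM [_ * `|c|]mulrC mulrA ler_wpM2r//.
apply: le_trans (ler_wpM2r (normr_ge0 _) Ds) _.
rewrite /eta -(mulrA (eps / 2)) ler_piMr ?(ltW eps2)//.
by rewrite mulrC ler_pdivrMr// mul1r lerDl.
Unshelve. all: by end_near. Qed.

(** The direction v is built from 0 by adding one multiple of a basis vector at a time with
    [is_deriveDr]. *)
Lemma is_derive_partial (R : realType) (n : nat) (f : 'rV[R]_n -> R)
    (x v : 'rV[R]_n) :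
  (forall i, \forall y \near x, derivable f y (delta_mx 0 i)) ->
  (forall i, {for x, continuous (partial i f)}) ->
  is_derive x v f (\sum_i v 0 i * partial i f x).
Proof.
move=> fd fc; have f0 : is_derive x (0 : 'rV[R]_n) f (0 : R) by exact: is_derive0.
rewrite {1}(row_sum_delta v); elim/big_rec2 : _ => [|i d w _ fw]; first exact: f0.
rewrite addrC (addrC (_ * _)).
by have H := is_deriveDr (v 0 i) fw (fd i); apply: H; exact: fc.
Qed.

(** * Measurability and comparison of integrals *)

Section measurability_rV.
Context {R : realType} {n : nat}.
Local Notation rV := 'rV[measurableTypeR R]_n.

Lemma measurable_box_rV (A : 'I_n -> set R) :
  (forall i, measurable (A i : set (measurableTypeR R))) ->
  measurable ([set v : rV | forall i, A i (v 0 i)] : set rV).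
Proof.
move=> mA; rewrite [X in measurable X](_ : _ =
    \bigcap_(i in [set: 'I_n]) ((fun v : rV => v 0 i) @^-1` A i)).
  apply: fin_bigcap_measurable => // i _; rewrite -[X in measurable X]setTI.
  exact: (@measurable_coord _ _ n).
by apply/seteqP; split => [v vA i _|v vA i]; apply: vA.
Qed.

(** Sup-norm balls are boxes, and those with rational centre and radius 1 / (k + 1) form a countable
    base of the topology. *)
Lemma rat_box_open (U : set 'rV[R]_n) (v : 'rV[R]_n) : open U -> U v ->
  exists z : 'rV[rat]_n * nat,
    (forall i, `|ratr (z.1 0 i) - v 0 i| < z.2.+1%:R^-1) /\
    [set w : 'rV[R]_n | forall i, `|ratr (z.1 0 i) - w 0 i| < z.2.+1%:R^-1] `<=` U.
Proof.
move=> oU Uv.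
have /nbhs_ballP[e/= e0 eU] := open_nbhs_nbhs (conj oU Uv).
(* Half of e, since v and w are each within one radius of the rational centre. *)
have [k ke] : exists k : nat, k.+1%:R^-1 < e / 2.
  have [k _ /(_ _ (leqnn _))] :=
    near_infty_natSinv_lt (PosNum (divr_gt0 e0 (ltr0n _ 2))).
  by exists k.
have k0 : 0 < k.+1%:R^-1 :> R by rewrite invr_gt0.
set eps : R := k.+1%:R^-1 in ke k0 *.
have cP i : exists q : rat, `|ratr q - v 0 i| < eps.
  have /rat_in_itvoo[q] : v 0 i - eps < v 0 i + eps by lra.
  by rewrite in_itv/= => qv; exists q; rewrite ltr_norml; lra.
have [c cE] := choice cP.
exists (\row_i c i, k); split=> [i|w bw]; first by rewrite /= mxE.
apply: eU; split=> // i0 i; rewrite !ord1 -ball_normE/=.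
have := bw i; rewrite /= mxE -/eps; have := cE i; rewrite !ltr_norml; move: ke; lra.
Qed.

(** The sigma-algebra is generated by coordinates, so an open set is written as the countable union
    of the rational boxes that it contains. *)
Lemma measurable_open_rV (U : set 'rV[R]_n) : open U -> measurable (U : set rV).
Proof.
move=> oU; pose box (z : 'rV[rat]_n * nat) : set rV :=
  [set v | forall i, `|ratr (z.1 0 i) - v 0 i| < z.2.+1%:R^-1].
have -> : U = \bigcup_z [set v : rV | box z v /\ box z `<=` U].
  apply/seteqP; split=> [v Uv|v [z _ [bv]]]; last exact.
  by have [z zv] := @rat_box_open U v oU Uv; exists z.
apply: countable_bigcupT_measurable => // z.
have [bU|bU] := pselect (box z `<=` U); last first.
  rewrite [X in measurable X](_ : _ = set0)//.
  by apply/seteqP; split=> v // [].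
rewrite [X in measurable X](_ : _ = box z); last first.
  by apply/seteqP; split=> v => [[]|].
apply: (@measurable_box_rV
  (fun i => [set r : R | `|ratr (z.1 0 i) - r| < z.2.+1%:R^-1])) => i.
rewrite [X in measurable X](_ : _ = ball (ratr (z.1 0 i) : R) z.2.+1%:R^-1).
  by apply: open_measurable; exact: ball_open.
by rewrite -ball_normE.
Qed.

Lemma open_continuous_measurable_rV (U : set 'rV[R]_n) (f : 'rV[R]_n -> R) :
  open U -> {within U, continuous f} -> measurable_fun (U : set rV) f.
Proof.
move=> oU cf; apply: (measurability _ (RGenOpens.measurableE R)).
move=> _ [_ [a [b ->] <-]]; apply: measurable_open_rV.
have /continuousP/(_ `]a, b[%classic) := cf.
move=> /(_ ltac:(exact: interval_open)).
move=> /open_subspaceP[V oV VU]; rewrite [X in open X](_ : _ = V `&` U).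
  exact: openI.
by rewrite VU setIC.
Qed.

Lemma lebesgue_rV_bounded (U : set 'rV[R]_n) : open U -> bounded_set U ->
  (lebesgue_rV n (U : set rV) < +oo)%E.
Proof.
move=> oU [M [Mreal UM]].
(* [bounded_set] only provides bounds strictly above M, hence the cube of half-side M + 1. *)
pose A (i : 'I_n) : set R := `[- (M + 1), M + 1]%classic.
have mA i : measurable (A i : set (measurableTypeR R)) by exact: measurable_itv.
apply: (@le_lt_trans _ _ (lebesgue_rV n [set v : rV | forall i, A i (v 0 i)])).
  apply: le_measure; rewrite ?inE.
  - exact: measurable_open_rV.
  - exact: measurable_box_rV.
  move=> v /(UM (M + 1)) => /(_ (ltac:(lra))) vM i.
  rewrite /A /= in_itv/= -ler_norml; apply: le_trans vM.
  rewrite /Num.Def.normr/= mx_normrE; apply: (le_bigmax _ _ (0, i)).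
have AE i : lebesgue_measure (A i) \is a fin_num.
  by rewrite lebesgue_measure_itv/=; case: ifP => // _; rewrite -EFinB.
by rewrite lebesgue_rV_box// ltey_eq prode_fin_num.
Qed.

End measurability_rV.

(** Serves both nonlocal terms, the memory integral and the boundary flux. The bound M and the
    finite measure provide the integrability behind monotonicity and additivity. *)
Lemma le_Rintegral_addcst d (T : measurableType d) (R : realType)
    (mu : {measure set T -> \bar R}) (D : set T) (f g : T -> R) (c M : R) :
  measurable D -> (mu D < +oo)%E -> measurable_fun D f -> measurable_fun D g ->
  (forall x, D x -> `|f x| <= M) -> (forall x, D x -> `|g x| <= M) ->
  (forall x, D x -> f x <= g x + c) ->
  \int[mu]_(x in D) f x <= \int[mu]_(x in D) g x + c * fine (mu D).
Proof.
move=> mD Doo mf mg fM gM fg.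
have bnd (h : T -> R) : (forall x, D x -> `|h x| <= M) ->
    [bounded h x | x in D].
  move=> hM; exists M; split; rewrite ?num_real// => y My x Dx.
  by apply: le_trans (hM _ Dx) _; exact: ltW.
have ig : mu.-integrable D (EFin \o g).
  by apply: measurable_bounded_integrable => //; exact: bnd.
have ic : mu.-integrable D (EFin \o cst c).
  apply: measurable_bounded_integrable => //.
  by exists `|c|; split; rewrite ?num_real// => y cy x _; exact: ltW.
rewrite -Rintegral_cst// -RintegralD//; apply: le_Rintegral => //.
  by apply: measurable_bounded_integrable => //; exact: bnd.
rewrite (_ : _ \o _ = (EFin \o g) \+ (EFin \o cst c))//; exact: integrableD.
Qed.

(** * Differences of powers *)

(** Bernoulli's inequality, by induction from 1 - s^(N+1) = (1 - s^N) + s^N (1 - s). *)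
Lemma one_sub_expr_le (R : realType) (N : nat) (s : R) : 0 <= s <= 1 ->
  1 - s ^+ N <= N%:R * (1 - s).
Proof.
move=> /andP[s0 s1]; elim: N => [|N IH]; first by rewrite expr0 subrr mul0r.
have sN : s ^+ N <= 1 by exact: exprn_ile1.
have : s ^+ N * (1 - s) <= 1 - s by rewrite ler_piMl// subr_ge0.
rewrite exprS -natr1; move: IH; lra.
Qed.

(* With y = x s and 0 <= s <= 1, the exponent is traded for an integer: s^r >= s^N. *)
Lemma powR_sub_le (R : realType) (N : nat) (r x y : R) :
  0 <= r <= N%:R -> 0 <= y <= x -> 0 < x ->
  x `^ r - y `^ r <= N%:R * (x `^ r / x) * (x - y).
Proof.
move=> /andP[r0 rN] /andP[y0 yx] x0.
have s01 : 0 <= y / x <= 1.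
  by rewrite divr_ge0 ?(ltW x0)//= ler_pdivrMr// mul1r.
have yE : y = x * (y / x) by rewrite mulrCA divff ?mulr1// gt_eqF.
have -> : N%:R * (x `^ r / x) * (x - y) = x `^ r * (N%:R * (1 - y / x)).
  by field; rewrite gt_eqF.
rewrite {1}yE powRM ?(ltW x0)//; last by case/andP: s01.
rewrite -{1}[x `^ r]mulr1 -mulrBr ler_wpM2l ?powR_ge0//.
apply: le_trans (one_sub_expr_le N s01); rewrite lerB//.
(* At s = 0 the power s^N is 1 when N = 0, but then r = 0 and s^r = 1 too. *)
have [s0|s0] := eqVneq (y / x) 0.
  rewrite s0 expr0n; have [N0|N0] := eqVneq N 0%N; last by rewrite powR_ge0.
  by rewrite (_ : r = 0) ?powRr0//; apply/eqP; rewrite eq_le r0 andbT (le_trans rN)// N0.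
case/andP: s01 => s1 s2.
by rewrite -powR_mulrn// ger_powR// s2 lt0r s0 s1.
Qed.

(** For r >= 1 the factor x^r / x = x^(r - 1) of [powR_sub_le] is at most M^(r - 1); for r = 0 both
    powers are 1, even at 0. *)
Lemma powR_sub_le_lipschitz (R : realType) (r M : R) : r = 0 \/ 1 <= r ->
  exists2 C, 0 <= C & forall x y, 0 <= y <= x -> x <= M ->
    x `^ r - y `^ r <= C * (x - y).
Proof.
move=> [->|r1].
  by exists 0 => // x y _ _; rewrite !powRr0 mul0r subrr.
have r0 : 0 <= r by lra.
exists ((Num.bound r)%:R * M `^ (r - 1)).
  by rewrite mulr_ge0 ?powR_ge0.
move=> x y yx xM; case/andP: (yx) => y0 yx'.
have [x0|x0] := eqVneq x 0.
  by rewrite (_ : y = x) ?subrr ?mulr0//; apply/eqP; rewrite eq_le yx' x0.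
have {}x0 : 0 < x by rewrite lt0r x0 (le_trans y0).
have rN : 0 <= r <= (Num.bound r)%:R.
  by rewrite r0 ltW//; have := archi_boundP r0.
apply: le_trans (powR_sub_le rN yx x0) _.
rewrite ler_wpM2r ?subr_ge0// ler_wpM2l//.
have -> : x `^ r / x = x `^ (r - 1) by rewrite powRB ?powRr1 ?ltW// (gt_eqF x0) implybT.
by apply: ge0_ler_powR; rewrite ?nnegrE ?subr_ge0//; lra.
Qed.

(** Keeping the larger argument x above e bounds x^r / x for r < 1 as well, and y may still
    vanish. *)
Lemma powR_sub_le_lipschitz_pos (R : realType) (r M e : R) : 0 <= r -> 0 < e ->
  exists2 C, 0 <= C & forall x y, 0 <= y <= x -> e <= x <= M ->
    x `^ r - y `^ r <= C * (x - y).
Proof.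
move=> r0 e0.
exists ((Num.bound r)%:R * (M `^ r / e)).
  by rewrite mulr_ge0// divr_ge0 ?powR_ge0 ?ltW.
move=> x y yx /andP[ex xM]; case/andP: (yx) => y0 yx'.
have x0 : 0 < x by lra.
have rN : 0 <= r <= (Num.bound r)%:R.
  by rewrite r0 ltW//; have := archi_boundP r0.
apply: le_trans (powR_sub_le rN yx x0) _.
rewrite ler_wpM2r ?subr_ge0// ler_wpM2l// ler_pM ?powR_ge0 ?invr_ge0 ?(ltW x0)//.
  by apply: ge0_ler_powR; rewrite ?nnegrE//; lra.
by rewrite lef_pV2.
Qed.

(** * Continuity relative to a set *)

Lemma within_continuous_compw (S T U : topologicalType) (A : set T) (B : set S)
    (f : T -> U) (g : S -> T) :
  {within A, continuous f} -> {within B, continuous g} ->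
  (forall x, B x -> A (g x)) -> {within B, continuous (f \o g)}.
Proof.
move=> /subspace_continuousP cf /subspace_continuousP cg BA.
apply/subspace_continuousP => x Bx.
apply: (@cvg_comp _ _ _ g f _ (within A (nbhs (g x)))); last exact/cf/BA.
move=> P AP.
have : \forall y \near within B (nbhs x), A (g y) -> P (g y).
  exact: (cg x Bx _ AP).
rewrite near_withinE => H; change (\forall y \near within B (nbhs x), P (g y)).
rewrite near_withinE; apply: filterS H => y yP By; apply: yP => //; exact: BA.
Qed.

Lemma within_continuousP (T : topologicalType) (R : realType) (A : set T)
    (f : T -> R) : {within A, continuous f} <->
  forall x e, A x -> 0 < e -> \forall y \near x, A y -> `|f x - f y| <= e.
Proof.
split=> [/subspace_continuousP cf x e Ax e0|cf].
  by move/cvgrPdist_le : (cf x Ax) => /(_ e e0); rewrite near_withinE.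
apply/subspace_continuousP => x Ax; apply/cvgrPdist_le => e e0.
by rewrite near_withinE; exact: cf.
Qed.

(** * Outward normals and normal derivatives *)

Definition dot (R : realType) (n : nat) (u v : 'rV[R]_n) : R :=
  \sum_i u 0 i * v 0 i.

Section dot_product.
Context {R : realType} {n : nat}.
Implicit Types u v w : 'rV[R]_n.

Lemma dotC u v : dot u v = dot v u.
Proof. by apply: eq_bigr => i _; rewrite mulrC. Qed.

Lemma dotDr u v w : dot u (v + w) = dot u v + dot u w.
Proof. by rewrite -big_split; apply: eq_bigr => i _; rewrite mxE mulrDr. Qed.

Lemma dotZr c u v : dot u (c *: v) = c * dot u v.
Proof. by rewrite mulr_sumr; apply: eq_bigr => i _; rewrite mxE mulrCA. Qed.

Lemma dotNr u v : dot u (- v) = - dot u v.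
Proof. by rewrite -scaleN1r dotZr mulN1r. Qed.

Lemma dotvv u : dot u u = \sum_i u 0 i ^+ 2.
Proof. by apply: eq_bigr => i _; rewrite expr2. Qed.

Lemma dotvv_ge0 u : 0 <= dot u u.
Proof. by rewrite dotvv sumr_ge0// => i _; rewrite sqr_ge0. Qed.

Lemma dotvv_gt0 u : u != 0 -> 0 < dot u u.
Proof.
rewrite lt0r dotvv_ge0 andbT; apply: contraNN => u0; apply/eqP/rowP => i.
rewrite mxE; apply/eqP; rewrite -sqrf_eq0; move: u0.
by rewrite dotvv psumr_eq0 => [/allP/(_ i (mem_index_enum _))|j _]; rewrite ?sqr_ge0.
Qed.

Lemma euclidean_normE u : euclidean_norm u = Num.sqrt (dot u u).
Proof. by rewrite /euclidean_norm dotvv. Qed.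

End dot_product.

Lemma is_derive_lt_right (R : realType) (V : normedModType R) (f : V -> R)
    (x v : V) (c d : R) : is_derive x v f d -> d < c ->
  \forall h \near (0 : R), 0 < h -> f (x + h *: v) < f x + c * h.
Proof.
move=> /is_deriveP fd dc; have e0 : 0 < (c - d) / 2 by lra.
apply: filterS (fd _ e0) => h; rewrite ler_norml => fh h0.
have : (c - d) / 2 * h < (c - d) * h by rewrite ltr_pM2r//; lra.
by move: fh; rewrite (gtr0_norm h0); lra.
Qed.

Lemma is_derive_gt_right (R : realType) (V : normedModType R) (f : V -> R)
    (x v : V) (c d : R) : is_derive x v f d -> c < d ->
  \forall h \near (0 : R), 0 < h -> f x + c * h < f (x + h *: v).
Proof.
move=> /is_deriveP fd dc; have e0 : 0 < (d - c) / 2 by lra.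
apply: filterS (fd _ e0) => h; rewrite ler_norml => fh h0.
have : (d - c) / 2 * h < (d - c) * h by rewrite ltr_pM2r//; lra.
by move: fh; rewrite (gtr0_norm h0); lra.
Qed.

Lemma near0_gt0 (R : realType) (P : set R) :
  (\forall h \near (0 : R), 0 < h -> P h) -> exists2 h, 0 < h & P h.
Proof.
move=> /nbhs_ballP[r/= r0 rP]; exists (r / 2); first lra.
by apply: rP; rewrite -?ball_normE/= ?add0r ?normrN ?gtr0_norm; lra.
Qed.

Lemma near_line (R : realType) (V : normedModType R) (P : set V) (x v : V) :
  (\forall y \near x, P y) -> \forall h \near (0 : R), P (x + h *: v).
Proof.
move=> /nbhs_ballP[r/= r0 rP]; have v1 : 0 < `|v| + 1 by rewrite ltr_wpDl.
apply/nbhs_ballP; exists (r / (`|v| + 1)) => /=; first by rewrite divr_gt0.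
move=> h; rewrite -ball_normE /= add0r normrN ltr_pdivlMr// => hr; apply: rP.
rewrite -ball_normE /= opprD addNKr normrN normrZ; apply: le_lt_trans hr.
by rewrite ler_wpM2l// lerDl.
Qed.

Lemma Ck1_derive (R : realType) (n : nat) (U : set 'rV[R]_n)
    (f : 'rV[R]_n -> R) (x v : 'rV[R]_n) :
  open U -> Ck 1 U f -> U x -> is_derive x v f (dot (grad f x) v).
Proof.
move=> oU [_ Cf] Ux; rewrite dotC /dot.
under eq_bigr do rewrite mxE.
apply: is_derive_partial => i; have [fd fc] := Cf i.
  by apply: filterS (open_nbhs_nbhs (conj oU Ux)) => y /fd.
have : {within U, continuous (partial i f)} by exact: fc.
by rewrite continuous_open_subspace//; apply; rewrite inE.
Qed.

(** Lets e tend to 0: with e / (p + 1) in place of e, the excess is at most e. *)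
Lemma mul_le_sqr_of_approx (R : realFieldType) (s t p : R) : 0 <= p ->
  (forall e, 0 < e -> s * t <= (p + e) * p) -> s * t <= p ^+ 2.
Proof.
move=> p0 H; apply/ler_addgt0Pr => e e0; have p1 : 0 < p + 1 by lra.
have := H (e / (p + 1)) (divr_gt0 e0 p1); rewrite mulrDl expr2.
have : e / (p + 1) * p <= e by rewrite mulrAC ler_pdivrMr// ler_wpM2l; lra.
lra.
Qed.

Section boundary.
Context {R : realType} {n : nat}.
Variable Omega : set 'rV[R]_n.

(* [nu] comes from a possibly different defining function [phi'].  Since [phi] and
   [phi'] have the same negativity set, a direction decreasing [phi] cannot
   increase [phi']; testing this with the directions
   (g.g) g' - (g.g' + e) g and - g shows that the gradients g of [phi] and g' of
   [phi'] are positively collinear. *)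
Lemma grad_dot_normal x U phi y nu : defining_function Omega x U phi -> U y ->
  bdry Omega y -> is_outward_unit_normal Omega y nu ->
  euclidean_norm (grad phi y) <= dot (grad phi y) nu.
Proof.
move=> [[oU _] sphi phiO phib gphi] Uy yb.
move=> [U' [phi' [[[oU' U'y] sphi' phiO' phib' gphi'] ->]]].
set g := grad phi y; set g' := grad phi' y.
(* Otherwise a short step along v from y, where both functions vanish, would reach a point with phi
   < 0 < phi'. *)
have key v : dot g v < 0 -> dot g' v <= 0.
  move=> gv; rewrite leNgt; apply/negP => gv'.
  have D := is_derive_lt_right (Ck1_derive v oU (sphi 1%N) Uy) gv.
  have D' := is_derive_gt_right (Ck1_derive v oU' (sphi' 1%N) U'y) gv'.
  have phiy : phi y = 0 by apply/phib.
  have phi'y : phi' y = 0 by apply/phib'.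
  have NU := near_line v (open_nbhs_nbhs (conj oU Uy)).
  have NU' := near_line v (open_nbhs_nbhs (conj oU' U'y)).
  have [|h h0 [H1 H2 H3 H4]] := @near0_gt0 R (fun h => [/\ phi (y + h *: v) < 0,
      0 < phi' (y + h *: v), U (y + h *: v) & U' (y + h *: v)]).
    near=> h => h0; split; [| |near: h; exact: NU|near: h; exact: NU'].
      suff : phi (y + h *: v) < phi y + 0 * h by rewrite phiy mul0r addr0.
      by move: h0; near: h.
    suff : phi' y + 0 * h < phi' (y + h *: v) by rewrite phi'y mul0r addr0.
    by move: h0; near: h.
  by have := (phiO' _ H4).1 ((phiO _ H3).2 H1); lra.
have S0 : 0 < dot g g by apply: dotvv_gt0; exact: gphi.
have S'0 : 0 < dot g' g' by apply: dotvv_gt0; exact: gphi'.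
have p0 : 0 <= dot g g'.
  by have := key (- g); rewrite !dotNr (dotC g') oppr_lt0 oppr_le0; apply.
(* The reverse of the Cauchy-Schwarz inequality, which amounts to collinearity. *)
have pS : dot g g * dot g' g' <= dot g g' ^+ 2.
  apply: mul_le_sqr_of_approx => // e e0.
  have := key (dot g g *: g' - (dot g g' + e) *: g).
  rewrite !dotDr !dotNr !dotZr (dotC g' g) subr_le0; apply.
  by rewrite mulrC -mulrBl opprD addNKr mulNr oppr_lt0 mulr_gt0.
rewrite dotZr !euclidean_normE ler_pdivlMl ?sqrtr_gt0// mulrC -sqrtrM ?dotvv_ge0//.
by rewrite -[leRHS]ger0_norm// -sqrtr_sqr ler_wsqrtr.
Unshelve. all: by end_near. Qed.

(** Moving along - nu decreases the defining function from its value 0 at x. The quotients in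
    [normal_derivative] therefore only see points of the domain besides x. *)
Lemma normal_inward x nu : bdry Omega x -> is_outward_unit_normal Omega x nu ->
  \forall h \near (0 : R), 0 < h -> Omega (x - h *: nu).
Proof.
move=> xb [U [phi [[[oU Ux] sphi phiO phib gphi] ->]]].
set g := grad phi x; set s := (euclidean_norm g)^-1.
have S0 : 0 < dot g g by apply: dotvv_gt0; exact: gphi.
have s0 : 0 < s by rewrite invr_gt0 euclidean_normE sqrtr_gt0.
have D : dot g (- (s *: g)) < 0 by rewrite dotNr dotZr oppr_lt0 mulr_gt0.
have := is_derive_lt_right (Ck1_derive (- (s *: g)) oU (sphi 1%N) Ux) D.
have := near_line (- (s *: g)) (open_nbhs_nbhs (conj oU Ux)).
have phix : phi x = 0 by apply/phib.
apply: filterS2 => h Uh fh h0; rewrite -scalerN; apply/phiO => //.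
by have := fh h0; rewrite phix mul0r addr0.
Qed.

Lemma normal_unit x nu : is_outward_unit_normal Omega x nu -> dot nu nu = 1.
Proof.
move=> [U [phi [[[oU Ux] sphi phiO phib gphi] ->]]].
set g := grad phi x.
have S0 : 0 < dot g g by apply: dotvv_gt0; exact: gphi.
rewrite dotZr dotC dotZr mulrA euclidean_normE -expr2 exprVn sqr_sqrtr ?ltW//.
by rewrite mulVf// gt_eqF.
Qed.

(** The mean value theorem on the segment from x to x - h nu, which is inside Omega except at x,
    reduces the quotient to the extended gradient at a point tending to x. Hence the [lim] in
    [normal_derivative] is a true limit. *)
Lemma normal_derivative_cvg x nu f (g : 'I_n -> 'rV[R]_n -> R) :
  bdry Omega x -> is_outward_unit_normal Omega x nu -> open Omega ->
  {within closure Omega, continuous f} ->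
  (forall i y, Omega y -> derivable f y (delta_mx 0 i)) ->
  (forall i, {within closure Omega, continuous (g i)}) ->
  (forall i y, Omega y -> g i y = partial i f y) ->
  (f x - f (x - h *: nu)) / h @[h --> 0^'+] --> \sum_i nu 0 i * g i x.
Proof.
move=> xb xnu oO cf fd cg gE; have cx : closure Omega x by case: xb.
pose D y := \sum_i nu 0 i * g i y.
have cD : D y @[y --> within (closure Omega) (nbhs x)] --> D x.
  apply: cvg_big => [|i _]; first exact: add_continuous.
  apply: cvgMr.
  by move/subspace_continuousP : (cg i) => /(_ x cx).
have dline h : Omega (x - h *: nu) ->
    is_derive h 1 (fun s : R => f (x - s *: nu)) (- D (x - h *: nu)).
  rewrite (_ : (fun s : R => _) = (fun s : R => f (x + s *: - nu))); last first.
    by apply/funext => s; rewrite scalerN.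
  move=> Oh; apply: is_derive_line.
  rewrite scalerN -sumrN (_ : \sum_i _ =
      \sum_i (- nu) 0 i * partial i f (x - h *: nu)); last first.
    by apply: eq_bigr => i _; rewrite mxE mulNr gE.
  apply: is_derive_partial => i.
    by apply: filterS (open_nbhs_nbhs (conj oO Oh)) => y /fd.
  have : {in Omega, continuous (partial i f)}.
    rewrite -continuous_open_subspace//.
    apply/within_continuousP => y e Oy e0.
    have /within_continuousP/(_ y e (subset_closure Oy) e0) := cg i.
    apply: filterS => z gyz Oz; rewrite -!gE//; apply: gyz.
    exact: subset_closure.
  by apply; rewrite inE.
apply/cvgrPdist_le => e e0.
have De : \forall y \near x, closure Omega y -> `|D x - D y| <= e.
  by move/cvgrPdist_le : cD => /(_ e e0); rewrite near_withinE.
have := near_line (- nu) De.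
have := normal_inward xb xnu.
move=> /nbhs_ballP[r/= r0 rO] /nbhs_ballP[q/= q0 qD].
have inb s : 0 < s -> s < r -> s < q ->
    Omega (x - s *: nu) /\ `|D x - D (x - s *: nu)| <= e.
  move=> s0 sr sq; have Os : Omega (x - s *: nu).
    by apply: rO => //; rewrite -ball_normE/= add0r normrN gtr0_norm.
  split=> //; have := qD s; rewrite scalerN; apply.
    by rewrite -ball_normE/= add0r normrN gtr0_norm.
  exact: subset_closure.
near=> h.
have h0 : 0 < h by near: h; exact: nbhs_right_gt.
have hr : h < r by near: h; exact: nbhs_right_lt.
have hq : h < q by near: h; exact: nbhs_right_lt.
have [//|s||c] := @MVT _ (fun s => f (x - s *: nu)) (fun s => - D (x - s *: nu)) 0 h.
- by rewrite in_itv/= => sh; apply: dline; apply: (inb _ _ _ _).1; lra.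
- apply: (within_continuous_compw cf).
    apply: continuous_subspaceT => s.
    by apply: cvgB; [exact: cvg_cst|apply: cvgZl; exact: cvg_id].
  move=> s; rewrite /= in_itv/= => /andP[s0 sh].
  have [->|s0'] := eqVneq s 0; first by rewrite scale0r subr0.
  apply: subset_closure; apply: (inb _ _ _ _).1; rewrite ?lt0r ?s0 ?s0'//; lra.
rewrite in_itv/= => ch; rewrite scale0r !subr0 => E.
have -> : (f x - f (x - h *: nu)) / h = D (x - c *: nu).
  by rewrite -opprB E mulNr mulfK ?opprK// gt_eqF.
by apply: (inb _ _ _ _).2; lra.
Unshelve. all: by end_near. Qed.

End boundary.

(** * The barrier *)

(** Reduces a directional derivative to a one-variable one at 0, so that the one-variable chain rule
    yields [is_derive_compR]. *)
Lemma is_derive_lineP (R : realType) (V : normedModType R) (f : V -> R)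
    (x v : V) (d : R) :
  is_derive x v f d <-> is_derive (0 : R) 1 (fun s => f (x + s *: v)) d.
Proof.
split=> [fd|/is_deriveP fd]; first by apply: is_derive_line; rewrite scale0r addr0.
apply/is_deriveP => e e0; apply: filterS (fd e e0) => h.
by rewrite add0r [h *: 1]mulr1 scale0r addr0.
Qed.

Lemma is_derive_compR (R : realType) (V : normedModType R) (g : R -> R)
    (f : V -> R) (x v : V) (c d : R) :
  is_derive (f x) 1 g c -> is_derive x v f d -> is_derive x v (g \o f) (c * d).
Proof.
move=> gc /is_derive_lineP fd; apply/is_derive_lineP.
by apply: (is_derive1_comp _ fd); rewrite /= scale0r addr0.
Qed.

(** The regularity that a second-derivative test along each coordinate line uses. *)
Definition twice_derivable (R : realType) (n : nat) (f : 'rV[R]_n -> R)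
    (x : 'rV[R]_n) : Prop :=
  forall i, (\forall y \near x, derivable f y (delta_mx 0 i)) /\
    derivable (partial i f) x (delta_mx 0 i).

Lemma is_derive_coord (R : realType) (n : nat) (x v : 'rV[R]_n) i :
  is_derive x v (fun y : 'rV[R]_n => y 0 i) (v 0 i).
Proof.
apply/is_deriveP => e e0; near=> h.
by rewrite !mxE (addrC (x 0 i)) addrK subrr normr0 mulr_ge0// ltW.
Unshelve. all: by end_near. Qed.

Lemma dot_sqrD (R : realType) (n : nat) (w v : 'rV[R]_n) h :
  dot (w + h *: v) (w + h *: v) = dot w w + h * (2 * dot w v) + h ^+ 2 * dot v v.
Proof.
rewrite dotDr dotZr !(dotC (w + h *: v)) !dotDr !dotZr (dotC v w); ring.
Qed.

Lemma dot_delta (R : realType) (n : nat) (u : 'rV[R]_n) i :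
  dot u (delta_mx 0 i) = u 0 i.
Proof.
rewrite /dot (bigD1 i)//= big1 ?addr0 ?mxE ?eqxx ?mulr1// => j ji.
by rewrite mxE eqxx (negbTE ji) mulr0.
Qed.

Lemma is_derive_dist2 (R : realType) (n : nat) (x v z : 'rV[R]_n) :
  is_derive x v (fun y => dot (y - z) (y - z)) (2 * dot (x - z) v).
Proof.
apply/is_deriveP => e e0.
have v1 : 0 < dot v v + 1 by rewrite ltr_wpDl ?dotvv_ge0.
apply/nbhs_ballP; exists (e / (dot v v + 1)) => /=; first by rewrite divr_gt0.
move=> h; rewrite -ball_normE /= add0r normrN => he.
rewrite [X in `|X|](_ : _ = h ^+ 2 * dot v v); last first.
  rewrite (_ : x + h *: v - z = (x - z) + h *: v); last by rewrite addrAC.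
  rewrite dot_sqrD; ring.
rewrite normrM (ger0_norm (dotvv_ge0 v)) normrX expr2 mulrAC ler_wpM2r//.
have : `|h| * (dot v v + 1) < e by rewrite -ltr_pdivlMr.
by have := normr_ge0 h; have := dotvv_ge0 v; lra.
Qed.

(** A larger M makes f steeper across the level phi = 0, where its gradient contains M grad phi,
    while the exponential stays at most 1 where phi <= 0. *)
Lemma twice_derivable_barrier (R : realType) (n : nat) (U : set 'rV[R]_n)
    (phi : 'rV[R]_n -> R) (M A : R) (z x : 'rV[R]_n) :
  open U -> Ck 2 U phi -> U x ->
  let f := fun y => 1 + expR (M * phi y) + A * dot (y - z) (y - z) in
  (forall v, is_derive x v f (expR (M * phi x) * (M * dot (grad phi x) v)
     + A * (2 * dot (x - z) v))) /\
  (twice_derivable f x /\ laplacian f x =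
    expR (M * phi x) * (M * laplacian phi x
      + M ^+ 2 * dot (grad phi x) (grad phi x)) + A * (2 * n%:R)).
Proof.
move=> oU C2 Ux f.
have fd y v : U y -> is_derive y v f (expR (M * phi y) * (M * dot (grad phi y) v)
     + A * (2 * dot (y - z) v)).
  move=> Uy; have C1 : Ck 1 U phi.
    have [c D] := C2; split=> // i; have [d [c' _]] := D i; split=> //.
  have dphi := Ck1_derive v oU C1 Uy.
  have D1 : is_derive y v (fun y => M * phi y) (M * dot (grad phi y) v) by exact: is_deriveZ.
  have D2 := @is_derive_compR R _ expR (fun y => M * phi y) y v _ _
    (is_derive_expR _) D1.
  have D3 : is_derive y v (fun y => A * dot (y - z) (y - z))
    (A * (2 * dot (y - z) v)) by apply: is_deriveZ; exact: is_derive_dist2.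
  have D4 : is_derive y v (fun=> 1 : R) 0 by exact: is_derive_cst.
  have := is_deriveD (is_deriveD D4 D2) D3.
  by rewrite add0r.
split=> [v|]; first exact: fd.
have nU := open_nbhs_nbhs (conj oU Ux).
(* [P i] is known to agree with [partial i f] on U, which is enough to differentiate the latter at
   x. *)
pose P i := fun y : 'rV[R]_n => expR (M * phi y) * (M * partial i phi y)
  + A * (2 * (y 0 i - z 0 i)).
have pfE i y : U y -> partial i f y = P i y.
  move=> Uy; rewrite /partial (derive_val (is_derive := fd y (delta_mx 0 i) Uy)).
  by rewrite !dot_delta !mxE.
have Pd i : is_derive x (delta_mx 0 i) (P i)
    (expR (M * phi x) * (M * partial i (partial i phi) x) +
     (M * partial i phi x) * (expR (M * phi x) * (M * partial i phi x))
     + A * (2 * 1)).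
  have dphi : is_derive x (delta_mx 0 i) phi (partial i phi x).
    by apply: derivableP; apply: (C2.2 i).1.
  have dpphi : is_derive x (delta_mx 0 i) (partial i phi)
      (partial i (partial i phi) x).
    by apply: derivableP; apply: ((C2.2 i).2.2 i).1.
  have D1 : is_derive x (delta_mx 0 i) (fun y => M * phi y)
    (M * partial i phi x) by exact: is_deriveZ.
  have D2 := @is_derive_compR R _ expR (fun y => M * phi y) x (delta_mx 0 i) _ _
    (is_derive_expR _) D1.
  have D3 : is_derive x (delta_mx 0 i) (fun y => M * partial i phi y)
    (M * partial i (partial i phi) x) by exact: is_deriveZ.
  have D4 : is_derive x (delta_mx 0 i) (fun y : 'rV[R]_n => A * (2 * (y 0 i - z 0 i)))
      (A * (2 * 1)).
    apply: is_deriveZ; apply: is_deriveZ.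
    have -> : (1 : R) = (delta_mx 0 i : 'rV[R]_n) 0 i - 0 by rewrite mxE !eqxx subr0.
    by apply: is_deriveB; exact: is_derive_coord.
  exact: (is_deriveD (is_deriveM D2 D3) D4).
have pfd i : is_derive x (delta_mx 0 i) (partial i f)
    (expR (M * phi x) * (M * partial i (partial i phi) x) +
     (M * partial i phi x) * (expR (M * phi x) * (M * partial i phi x))
     + A * (2 * 1)).
  apply: near_eq_is_derive (Pd i).
  by apply: filterS nU => y Uy; rewrite pfE.
split=> [i|].
  split; last by have [] := pfd i.
  by apply: filterS nU => y Uy; have [] := fd y (delta_mx 0 i) Uy.
have pfdE i : partial i (partial i f) x = expR (M * phi x) *
    (M * partial i (partial i phi) x + M ^+ 2 * (grad phi x 0 i * grad phi x 0 i))
    + A * 2.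
  rewrite {1}/partial (derive_val (is_derive := pfd i)) mxE; ring.
transitivity (\sum_i (expR (M * phi x) * (M * partial i (partial i phi) x +
    M ^+ 2 * (grad phi x 0 i * grad phi x 0 i)) + A * 2)).
  by apply: eq_bigr => i _; exact: pfdE.
rewrite big_split/= -mulr_sumr big_split/= -!mulr_sumr.
by rewrite sumr_const card_ord -(mulr_natr 2).
Qed.

Section barrier.
Context {R : realType} {n : nat}.
Variables (Omega : set 'rV[R]_n) (nu : 'rV[R]_n -> 'rV[R]_n).
Context
  (nuP : forall x, bdry Omega x -> is_outward_unit_normal Omega x (nu x)).

(* [B] bounds the outward normal derivative from below, even if [phi] is not
   differentiable. *)
Definition steep (B : R) (phi : 'rV[R]_n -> R) (x : 'rV[R]_n) : Prop :=
  \forall h \near (0 : R), 0 < h -> phi (x - h *: nu x) <= phi x - B * h.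

(* Laplacian at most [L] in the viscosity sense, a notion stable under minima. *)
Definition touched_above (L : R) (phi : 'rV[R]_n -> R) (x : 'rV[R]_n) : Prop :=
  exists f, [/\ f x = phi x, \forall y \near x, Omega y -> phi y <= f y,
    twice_derivable f x & laplacian f x <= L].

Lemma closure_bdry x : closure Omega x -> Omega x \/ bdry Omega x.
Proof.
move=> cx; have [|Ox] := pselect (Omega x); [by left|right].
by split=> // /interior_subset.
Qed.

Lemma dist2_ge (z y : 'rV[R]_n) i : (y 0 i - z 0 i) ^+ 2 <= dot (y - z) (y - z).
Proof.
rewrite dotvv (bigD1 i)//= !mxE lerDl sumr_ge0// => j _; exact: sqr_ge0.
Qed.

(** Links the Euclidean distance used in the barrier to the sup norm behind [ball]. *)
Lemma dist2_lt_ball (z y : 'rV[R]_n) r : 0 < r ->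
  dot (y - z) (y - z) < r ^+ 2 -> ball z r y.
Proof.
move=> r0 yr; split=> // i0 i; rewrite ord1 -ball_normE /= distrC.
rewrite -(@ltr_pXn2r _ 2)// ?nnegrE ?(ltW r0)// -normrX ger0_norm ?sqr_ge0//.
exact: le_lt_trans (dist2_ge _ _ _) yr.
Qed.

Lemma for_continuous_sum (F : 'I_n -> 'rV[R]_n -> R) (z : 'rV[R]_n) :
  (forall i, {for z, continuous (F i)}) ->
  {for z, continuous (fun y => \sum_i F i y)}.
Proof.
move=> cF; apply: (@cvg_big _ _ _ _ _ _ _ (nbhs z)) => [|i _]; last exact: cF.
exact: add_continuous.
Qed.

Lemma continuous_dist2 (z : 'rV[R]_n) :
  continuous (fun y : 'rV[R]_n => dot (y - z) (y - z)).
Proof.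
move=> y; apply: for_continuous_sum => i.
have c : {for y, continuous (fun y : 'rV[R]_n => (y - z) 0 i)}.
  rewrite (_ : (fun y => _) = fun y : 'rV[R]_n => y 0 i - z 0 i); last first.
    by apply/funext => w; rewrite !mxE.
  by apply: continuousB; [exact: (@coord_continuous R 1 n 0 i y)|exact: cst_continuous].
exact: continuousM.
Qed.

Lemma dist_le_bounds (x y e : R) : `|x - y| <= e -> x - e <= y <= `|x| + e.
Proof. by have := ler_norm x; rewrite ler_norml; lra. Qed.

(* Weight 2 / r^2: [f] exceeds 5/2 before the edge of the ball of radius [r], and
   is at most 9/4 on the set where the squared distance to [z] is below r^2 / 8. *)
Definition local_barrier (B : R) (z : 'rV[R]_n) (r : R) (f : 'rV[R]_n -> R)
    (L : R) : Prop := let N y := dot (y - z) (y - z) in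
  [/\ 0 < r, forall x, N x < r ^+ 2 -> {for x, continuous f},
    forall x, N x < r ^+ 2 -> closure Omega x ->
      1 + 2 / r ^+ 2 * N x <= f x <= 2 + 2 / r ^+ 2 * N x,
    forall x, N x < r ^+ 2 -> Omega x -> twice_derivable f x /\ laplacian f x <= L
  & forall x, N x < r ^+ 2 -> bdry Omega x -> steep B f x].

(** On the closure phi <= 0, so the exponential lies in (0, 1] and the bounds on f follow. On the
    boundary the slope comes from M |grad phi|, since the normal is parallel to grad phi. *)
Lemma exists_local_barrier (B : R) (z : 'rV[R]_n) : bdry Omega z ->
  smooth_boundary Omega -> exists r f L, local_barrier B z r f L.
Proof.
move=> zb /(_ z zb)[U [phi def]]; have [[oU Uz] sphi phiO phib gphi] := def.
pose S y := dot (grad phi y) (grad phi y).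
have C2 := sphi 2%N.
have cU g : Ck 0 U g -> {for z, continuous g}.
  move=> cg; have : {within U, continuous g} by exact: cg.
  by rewrite continuous_open_subspace//; apply; rewrite inE.
have cS : {for z, continuous S}.
  apply: for_continuous_sum => i.
  have c : {for z, continuous (fun y => grad phi y 0 i)}.
    rewrite (_ : (fun y => _) = partial i phi); last by apply/funext => y; rewrite mxE.
    exact: (cU _ ((sphi 1%N).2 i).2).
  exact: continuousM.
have cL : {for z, continuous (laplacian phi)}.
  apply: for_continuous_sum => i.
  exact: (cU _ ((C2.2 i).2.2 i).2).
have Sz : 0 < S z by apply: dotvv_gt0; exact: gphi.
have near_bounds : \forall y \near z,
    [/\ U y, `|S z - S y| <= S z / 2 & `|laplacian phi z - laplacian phi y| <= 1].
  near=> y; split; near: y; first exact: (open_nbhs_nbhs (conj oU Uz)).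
    by move/cvgrPdist_le : cS; apply; lra.
  by move/cvgrPdist_le : cL; apply.
have /nbhs_ballP[r/= r0 rP] := near_bounds.
(* On the ball S stays above S z / 2, so c bounds |grad phi| from below there. *)
pose A := 2 / r ^+ 2; pose c := Num.sqrt (S z - S z / 2).
have c0 : 0 < c by rewrite sqrtr_gt0; lra.
have r20 : 0 < r ^+ 2 by rewrite exprn_gt0.
have A0 : 0 < A by rewrite divr_gt0.
(* M c pays for the slope B and for the quadratic term, at worst A (r^2 + 1) = 2 + A, with 1 to
   spare for strictness. *)
pose M := (`|B| + 3 + A) / c.
have M0 : 0 < M by rewrite divr_gt0//; have := normr_ge0 B; lra.
pose f y := 1 + expR (M * phi y) + A * dot (y - z) (y - z).
pose L := M * (`|laplacian phi z| + 1) + M ^+ 2 * (`|S z| + S z / 2) + A * (2 * n%:R).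
pose N y := dot (y - z) (y - z); exists r, f, L; rewrite /local_barrier; cbv zeta.
have inU x : N x < r ^+ 2 -> [/\ U x, S z - S z / 2 <= S x <= `|S z| + S z / 2
    & laplacian phi x <= `|laplacian phi z| + 1].
  move=> /(dist2_lt_ball r0)/rP[Ux Sx Lx]; split=> //.
    exact: dist_le_bounds.
  by case/andP : (dist_le_bounds Lx).
have phi0 x : N x < r ^+ 2 -> closure Omega x -> phi x <= 0.
  move=> /inU[Ux _ _] /closure_bdry[|] Ox; first by apply/ltW/phiO.
  by rewrite (phib _ Ux).1.
have exp1 x : N x < r ^+ 2 -> closure Omega x -> 0 < expR (M * phi x) <= 1.
  move=> Nx cx; rewrite expR_gt0/= -expR0 ler_expR.
  by rewrite pmulr_rle0//; exact: phi0.
split=> // x Nx.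
- have [Ux _ _] := inU x Nx.
  have cphi : {for x, continuous phi}.
    have : {within U, continuous phi} by exact: (sphi 0%N).
    by rewrite continuous_open_subspace//; apply; rewrite inE.
  have cexp : {for x, continuous (fun y : 'rV[R]_n => expR (M * phi y))}.
    apply: (@continuous_comp _ _ _ (fun y => M * phi y) expR).
      by apply: continuousM; [exact: cst_continuous|exact: cphi].
    exact: continuous_expR.
  have cN : {for x, continuous (fun y : 'rV[R]_n => A * dot (y - z) (y - z))}.
    by apply: continuousM; [exact: cst_continuous|exact: continuous_dist2].
  by apply: (continuousD _ cN); apply: (continuousD _ cexp); exact: cst_continuous.
- by move=> cx; rewrite /f -/A -/(N x); have := exp1 x Nx cx; lra.
- move=> Ox; have [Ux Sx Lx] := inU x Nx.
  have [_ [tf ->]] := twice_derivable_barrier M A z oU C2 Ux; split=> //.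
  have /andP[e0 e1] := exp1 x Nx (subset_closure Ox).
  rewrite /L lerD2r.
  apply: (@le_trans _ _ (expR (M * phi x) *
     (M * (`|laplacian phi z| + 1) + M ^+ 2 * (`|S z| + S z / 2)))).
    rewrite ler_pM2l// lerD// ler_pM2l ?exprn_gt0//.
    by case/andP : Sx.
  rewrite ler_piMl//; apply: addr_ge0; first by rewrite mulr_ge0 ?addr_ge0 ?(ltW M0)//.
  by rewrite mulr_ge0 ?sqr_ge0 ?addr_ge0 ?divr_ge0 ?(ltW Sz)//.
- move=> xb; have [Ux Sx Lx] := inU x Nx.
  have [/(_ (- nu x)) fd _] := twice_derivable_barrier M A z oU C2 Ux.
  rewrite (_ : phi x = 0) in fd; last by apply/phib.
  have fB : expR (M * 0) * (M * dot (grad phi x) (- nu x)) +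
        A * (2 * dot (x - z) (- nu x)) < - B.
    rewrite mulr0 expR0 mul1r !dotNr !mulrN.
    have g1 : c <= dot (grad phi x) (nu x).
      apply: le_trans (grad_dot_normal def Ux xb (nuP xb)).
      by rewrite euclidean_normE ler_wsqrtr//; case/andP : Sx.
    (* From |x - z + nu|^2 >= 0 and |nu| = 1. *)
    have g2 : - (2 * dot (x - z) (nu x)) <= r ^+ 2 + 1.
      have := dotvv_ge0 (x - z + 1 *: nu x).
      rewrite dot_sqrD (normal_unit (nuP xb)) mul1r expr1n mul1r.
      by move: Nx; clear; lra.
    have : M * c <= M * dot (grad phi x) (nu x) by rewrite ler_pM2l.
    have : A * - (2 * dot (x - z) (nu x)) <= A * (r ^+ 2 + 1) by rewrite ler_pM2l.
    rewrite mulrDr (_ : A * r ^+ 2 = 2); last by rewrite /A divfK// gt_eqF.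
    rewrite (_ : M * c = `|B| + 3 + A); last by rewrite /M divfK// gt_eqF.
    by rewrite mulrN; have := ler_norm B; clear; lra.
  have := is_derive_lt_right fd fB; apply: filterS => h fh h0.
  by have := fh h0; rewrite scalerN mulNr => /ltW.
Unshelve. all: by end_near. Qed.

(** Invariant of the induction over a finite cover. The function starts as the constant 5/2; V
    collects the places where it has been lowered, and at a boundary point a value below 5/2
    guarantees the slope. *)
Definition barrier_on (B : R) (V : set 'rV[R]_n) (phi : 'rV[R]_n -> R)
    (L : R) : Prop :=
  [/\ {within closure Omega, continuous phi},
    forall x, closure Omega x -> 1 <= phi x <= 5 / 2,
    forall x, closure Omega x -> V x -> phi x < 5 / 2,
    forall x, Omega x -> touched_above L phi x
  & forall x, bdry Omega x -> phi x < 5 / 2 -> steep B phi x].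

Lemma min_dist_le (x y x' y' e : R) : `|x - x'| <= e -> `|y - y'| <= e ->
  `|Num.min x y - Num.min x' y'| <= e.
Proof. by rewrite !ler_norml !minEle; case: ifP; case: ifP; lra. Qed.

(* The minimum of [phi] and [f] inside the ball extends continuously by [phi],
   because near the sphere [f] exceeds 5/2 >= phi. *)
Lemma barrier_on_setU B V phi L z r f Lf : barrier_on B V phi L ->
  local_barrier B z r f Lf -> exists phi' L',
  barrier_on B (V `|` [set x | dot (x - z) (x - z) < r ^+ 2 / 8]) phi' L'.
Proof.
move=> [cphi phi1 phiV phiO phib] [r0 cf f1 fO fb].
pose N (y : 'rV[R]_n) := dot (y - z) (y - z).
have r20 : 0 < r ^+ 2 by rewrite exprn_gt0.
have cN x : {for x, continuous N} by exact: continuous_dist2.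
pose g y := if N y < r ^+ 2 then Num.min (phi y) (f y) else phi y.
have g_phi y : g y <= phi y by rewrite /g; case: ifP => // _; rewrite ge_min lexx.
have g_f y : N y < r ^+ 2 -> g y <= f y.
  by move=> Ny; rewrite /g Ny ge_min lexx orbT.
have gE y : g y = phi y \/ N y < r ^+ 2 /\ g y = f y.
  by rewrite /g; case: ifP => Ny; [rewrite minEle; case: ifP|]; auto.
have nearN x : N x < r ^+ 2 -> \forall y \near x, N y < r ^+ 2.
  by move=> Nx; exact: (cvgr_lt _ (cN x) _ Nx).
have farN x : ~ (N x < r ^+ 2) -> \forall y \near x, closure Omega y -> g y = phi y.
  move=> /negP; rewrite -leNgt => Nx.
  (* At N = 3 r^2 / 4 the lower bound 1 + 2 N / r^2 for f reaches 5/2. *)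
  have Nx' : r ^+ 2 * (3 / 4) < N x by lra.
  apply: filterS (cvgr_gt _ (cN x) _ Nx') => y Ny cy; rewrite /g.
  case: ifP => // Ny'; rewrite min_l//.
  have /andP[+ _] := f1 y Ny' cy; have := phi1 y cy.
  have : 3 / 2 < 2 / r ^+ 2 * N y.
    by rewrite mulrAC ltr_pdivlMr//; lra.
  rewrite -/(N y); lra.
exists g, (Num.max L Lf); split.
- apply/within_continuousP => x e cx e0.
  have /within_continuousP/(_ x e cx e0) cphix := cphi.
  have [Nx|Nx] := pselect (N x < r ^+ 2).
    have := cf x Nx; move/cvgrPdist_le => /(_ e e0).
    apply: filterS3 cphix (nearN x Nx) => y pxy Ny fxy cy.
    by rewrite /g Nx Ny; apply: min_dist_le => //; exact: pxy.
  have := farN x Nx; apply: filterS2 cphix => y pxy gy cy; rewrite gy//.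
  by rewrite /g (negbTE (introN idP Nx)); exact: pxy.
- move=> x cx; rewrite (le_trans (g_phi x))//=; last by case/andP : (phi1 x cx).
  rewrite andbT; have [->|[Nx ->]] := gE x; first by case/andP : (phi1 x cx).
  have /andP[+ _] := f1 x Nx cx; apply: le_trans; rewrite lerDl mulr_ge0 ?dotvv_ge0//.
  by rewrite divr_ge0// ltW.
- move=> x cx [Vx|/= Nx]; first exact: le_lt_trans (phiV x cx Vx).
  have Nx' : N x < r ^+ 2 by rewrite /N; lra.
  apply: le_lt_trans (g_f x Nx') _; have /andP[_ +] := f1 x Nx' cx.
  move=> /le_lt_trans; apply; rewrite -/(N x) mulrAC.
  have : 2 * N x / r ^+ 2 < 1 / 2 by rewrite ltr_pdivrMr//; rewrite /N; lra.
  lra.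
(* At x the function g equals phi or f and lies below that one nearby, so its touching function, and
   in the next bullet its slope, serve for g. *)
- move=> x Ox; have [gx|[Nx gx]] := gE x.
    have [h [h1 h2 h3 h4]] := phiO x Ox.
    exists h; split; rewrite ?gx// ?le_max ?h4//.
    by apply: filterS h2 => y /[apply]; exact: le_trans.
  have [f2 fL] := fO x Nx Ox; exists f; split=> //; last by rewrite le_max fL orbT.
  by apply: filterS (nearN x Nx) => y Ny _; exact: g_f.
- move=> x xb; have [gx|[Nx gx]] := gE x; rewrite gx => g52.
    have := phib x xb g52; apply: filterS => h /[apply]; rewrite -gx.
    by apply: le_trans.
  have := near_line (- nu x) (nearN x Nx).
  apply: filterS2 (fb x Nx xb) => h fh; rewrite scalerN => Nh h0.
  by rewrite gx; apply: le_trans (g_f _ Nh) (fh h0).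
Qed.

Lemma compact_closure_bounded : bounded_set Omega -> compact (closure Omega).
Proof.
move=> [M [Mr MO]]; apply: bounded_closed_compact; last exact: closed_closure.
exists M; split=> // x Mx.
have : closed [set y : 'rV[R]_n | `|y| <= x].
  have := @preimage_closed _ _ (fun y : 'rV[R]_n => `|y|) [set s | s <= x].
  by apply; [move=> y _; exact: norm_continuous|exact: closed_le].
move=> /closure_id cE y cy; suff : [set y : 'rV[R]_n | `|y| <= x] y by [].
by rewrite cE; apply: closure_subset cy => z Oz; exact: MO.
Qed.

Lemma compact_bdry : bounded_set Omega -> compact (bdry Omega).
Proof.
move=> bO; rewrite /bdry setDE; apply: compact_closedI.
  exact: compact_closure_bounded.
by apply: open_closedC; exact: open_interior.
Qed.

Lemma twice_derivable_cst (c : R) (x : 'rV[R]_n) :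
  twice_derivable (fun=> c) x /\ laplacian (fun=> c) x = 0.
Proof.
have pE i (d : R) : partial i (fun _ : 'rV[R]_n => d) = fun=> 0.
  by apply/funext => y; exact: derive_cst.
split=> [i|].
  by split; [near=> y; exact: derivable_cst|rewrite pE; exact: derivable_cst].
by rewrite /laplacian big1// => i _; rewrite !pE.
Unshelve. all: by end_near. Qed.

(** By compactness, finitely many of the sets where local barriers drop below 5/2 cover the
    boundary. Adding them one by one lowers phi below 5/2 at every boundary point, where it is then
    steep. *)
Lemma exists_barrier (B : R) : bounded_set Omega -> smooth_boundary Omega ->
  exists (phi : 'rV[R]_n -> R) (L : R), [/\ {within closure Omega, continuous phi},
    forall x, closure Omega x -> 1 <= phi x <= 5 / 2,
    forall x, Omega x -> touched_above L phi x
  & forall x, bdry Omega x -> steep B phi x].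
Proof.
move=> bO sO.
(* [choice] asks for a radius at every z; off the boundary 0 is a dummy value. *)
have loc z : exists r, bdry Omega z -> exists f L, local_barrier B z r f L.
  have [zb|zb] := pselect (bdry Omega z); last by exists 0.
  by have [r rz] := exists_local_barrier B zb sO; exists r.
have [r rP] := choice loc.
pose V z := [set x : 'rV[R]_n | dot (x - z) (x - z) < r z ^+ 2 / 8].
have oV z : open (V z).
  exact: (open_comp (fun x _ => @continuous_dist2 z x) (@open_lt _ _)).
have Vz z : bdry Omega z -> V z z.
  move=> /rP[f [L [r0 _ _ _ _]]]; rewrite /V/= subrr dotvv big1 => [|i _].
    by rewrite divr_gt0// exprn_gt0.
  by rewrite mxE expr0n.
have := compact_bdry bO; rewrite compact_cover.
move=> /(_ _ (bdry Omega) V (fun z _ => oV z))[z zb|D' D'b bD'].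
  by exists z => //; exact: Vz.
have : exists phi L, barrier_on B (\bigcup_(z in [set` enum_fset D']) V z) phi L.
  have : {subset enum_fset D' <= bdry Omega} by move=> z; exact: D'b.
  elim: (enum_fset D') => [_|z s IH zs].
    exists (fun=> 5 / 2), 0; split.
    - by apply: continuous_subspaceT => x; exact: cst_continuous.
    - by move=> x _; lra.
    - by move=> x _ [].
    - move=> x _; exists (fun=> 5 / 2); split=> //.
      + by near=> y.
      + exact: (twice_derivable_cst _ _).1.
      + by rewrite (twice_derivable_cst _ _).2.
    - by move=> x _; rewrite ltxx.
  have [|phi [L phiL]] := IH.
    by move=> y ys; apply: zs; rewrite inE ys orbT.
  have zb : bdry Omega z by apply: set_mem; apply: zs; rewrite inE eqxx.
  have [f [Lf fP]] := rP z zb.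
  have [phi' [L' [cphi' phi1 phiV phiO phib]]] := barrier_on_setU phiL fP.
  exists phi', L'; split=> // x cx [y /=]; rewrite inE => /orP[/eqP ->|ys] Vx.
    by apply: phiV => //; right.
  by apply: phiV => //; left; exists y.
move=> [phi [L [cphi phi1 phiV phiO phib]]]; exists phi, L; split=> // x xb.
by apply: phib => //; apply: phiV; [case: xb|exact: bD'].
Unshelve. all: by end_near. Qed.

End barrier.

(** * The maximum principle *)

(** The second-derivative test is applied to F - G - c f on each coordinate line through x, and the
    inequalities are summed. *)
Lemma laplacian_le_at_max (R : realType) (n : nat) (F G f : 'rV[R]_n -> R)
    (c : R) (x : 'rV[R]_n) :
  twice_derivable F x -> twice_derivable G x -> twice_derivable f x ->
  (\forall y \near x, F y - G y - c * f y <= F x - G x - c * f x) ->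
  laplacian F x <= laplacian G x + c * laplacian f x.
Proof.
move=> F2 G2 f2 mx; rewrite /laplacian mulr_sumr -big_split; apply: ler_sum => i _ /=.
have [Fd Fdd] := F2 i; have [Gd Gdd] := G2 i; have [fd fdd] := f2 i.
pose e : 'rV[R]_n := delta_mx 0 i.
pose h (s : R) := F (x + s *: e) - G (x + s *: e) - c * f (x + s *: e).
pose dh (s : R) := partial i F (x + s *: e) - partial i G (x + s *: e)
  - c * partial i f (x + s *: e).
have line (g : 'rV[R]_n -> R) (s d : R) : is_derive (x + s *: e) e g d ->
    is_derive s 1 (fun r => g (x + r *: e)) d by exact: is_derive_line.
have Dh : \forall s \near (0 : R), is_derive (s : R) 1 h (dh s).
  have := near_line e Fd; have := near_line e Gd; have := near_line e fd.
  apply: filterS3 => s /derivableP fs /derivableP Gs /derivableP Fs.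
  exact: (is_deriveB (is_deriveB (line _ _ _ Fs) (line _ _ _ Gs))
    (is_deriveZ c (line _ _ _ fs))).
have Ddh : is_derive (0 : R) 1 dh (partial i (partial i F) x
    - partial i (partial i G) x - c * partial i (partial i f) x).
  have at0 (g : 'rV[R]_n -> R) : derivable g x e ->
      is_derive (0 : R) 1 (fun s => g (x + s *: e)) ('D_e g x).
    by move=> /derivableP ge; apply: line; rewrite scale0r addr0.
  exact: (is_deriveB (is_deriveB (at0 _ Fdd) (at0 _ Gdd)) (is_deriveZ c (at0 _ fdd))).
have Ddh' : is_derive (0 : R) 1 (derive1 h) (partial i (partial i F) x
    - partial i (partial i G) x - c * partial i (partial i f) x).
  apply: near_eq_is_derive Ddh; apply: filterS Dh => s Ds.
  by rewrite derive1E derive_val.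
rewrite -subr_le0 opprD addrA.
apply: (second_derive_le0_at_max _ Ddh'); first by apply: filterS Dh => s [].
have := near_line e mx; apply: filterS => s.
by rewrite /h scale0r addr0.
Qed.

(** * The space-time cylinder *)

Section cylinder.
Context {R : realType} {n : nat}.
Variables (Omega : set 'rV[R]_n) (T : R).
Context (oO : open Omega) (T0 : 0 < T).

Lemma cylinderP x t : (QT Omega T `|` GammaT Omega T) (x, t) <->
  closure Omega x /\ 0 <= t < T.
Proof.
split.
  rewrite /QT /GammaT /ST /=; case=> [[Ox]|[[[cx _]]|[cx ->]]].
  - by rewrite in_itv/= => /andP[t0 tT]; split; [exact: subset_closure|rewrite ltW].
  - by rewrite in_itv/= => /andP[t0 tT]; rewrite ltW.
  - by rewrite lexx.
move=> [cx /andP[]]; rewrite le_eqVlt => /predU1P[<- _|t0 tT]; first by right; right.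
have tI : `]0, T[%classic t by rewrite /= in_itv/= t0.
by have [Ox|xb] := closure_bdry cx; [left|right; left].
Qed.

Lemma C10_continuous u t1 : C10 Omega T u -> t1 < T ->
  {within closure Omega `*` `[0, t1], continuous (fun z => u z.1 z.2)}.
Proof.
move=> [cu _] t1T; apply: continuous_subspaceW cu => -[x t] /= [cx].
rewrite in_itv/= => /andP[t0 tt1]; apply/cylinderP; split=> //.
by rewrite t0 (le_lt_trans tt1).
Qed.

Lemma C10_continuous_slice (g : 'rV[R]_n * R -> R) t :
  {within QT Omega T `|` GammaT Omega T, continuous g} -> 0 <= t < T ->
  {within closure Omega, continuous (fun x => g (x, t))}.
Proof.
move=> cg tT.
apply: (@within_continuous_compw _ _ _ _ _ g (fun x : 'rV[R]_n => (x, t)) cg).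
  apply: continuous_subspaceT => x A [[U V] /= [Ux Vt] UV].
  by apply: filterS Ux => y Uy; apply: UV; split=> //; exact: nbhs_singleton.
by move=> x cx; apply/cylinderP.
Qed.

Lemma C21_twice_derivable u x t : C21 Omega T u -> Omega x -> 0 < t < T ->
  twice_derivable (u ^~ t) x.
Proof.
move=> [_ _ C1 C2] Ox tT i.
have tI : `]0, T[%classic t by rewrite /= in_itv.
split; last by apply: (C2 i i).1.
by apply: filterS (open_nbhs_nbhs (conj oO Ox)) => y Oy; apply: (C1 i).1.
Qed.

Lemma C10_normal_derivative_cvg u (nu : 'rV[R]_n) x t : C10 Omega T u ->
  bdry Omega x -> is_outward_unit_normal Omega x nu -> 0 < t < T ->
  (u x t - u (x - h *: nu) t) / h @[h --> 0^'+] -->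
    normal_derivative nu (u ^~ t) x.
Proof.
move=> [cu du] xb xnu /andP[t0 tT].
have tI : 0 <= t < T by rewrite ltW.
pose P i (g : 'rV[R]_n * R -> R) :=
  {within QT Omega T `|` GammaT Omega T, continuous g} /\
  forall x t, Omega x -> 0 <= t < T -> g (x, t) = partial i (u ^~ t) x.
have Pex i : exists g, P i g by have [_ [g g1 g2]] := du i; exists g.
have [g gP] := choice Pex.
have := @normal_derivative_cvg _ _ Omega x nu (u ^~ t) (fun i y => g i (y, t)) xb xnu oO.
have H : forall y i, Omega y -> derivable (u ^~ t) y (delta_mx 0 i).
  by move=> y i Oy; apply: (du i).1.
move=> /(_ (C10_continuous_slice cu tI) (fun i y => H y i)).
move=> /(_ (fun i => C10_continuous_slice (gP i).1 tI)).
move=> /(_ (fun i y Oy => (gP i).2 y t Oy tI)) cv.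
by rewrite /normal_derivative (cvg_lim _ cv).
Qed.

End cylinder.

(** * Estimates for the nonlinear and nonlocal terms *)

(** Where o <= u the Lipschitz bounds apply; elsewhere the difference of powers is nonpositive by
    monotonicity. The bound e is asked of u only where o <= u, so a positive lower bound of either
    function provides it. *)
Lemma power_comparison (R : realType) (X : Type) (K : set X) (u o : X -> R)
    (r M : R) :
  (forall z, K z -> 0 <= u z <= M) -> (forall z, K z -> 0 <= o z) ->
  (r = 0 \/ 1 <= r) \/
    (0 <= r /\ exists2 e, 0 < e & forall z, K z -> o z <= u z -> e <= u z) ->
  exists2 C, 0 <= C & forall z D, K z -> 0 <= D -> u z - o z <= D ->
    u z `^ r - o z `^ r <= C * D.
Proof.
move=> uM o0 rP; have r0 : 0 <= r by case: rP => [[->|]|[]] //; apply: le_trans.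
have [C C0 CP] : exists2 C, 0 <= C & forall z, K z -> o z <= u z ->
    u z `^ r - o z `^ r <= C * (u z - o z).
  case: rP => [r1|[_ [e e0 eu]]].
    have [C C0 CP] := powR_sub_le_lipschitz M r1; exists C => // z Kz ou.
    by apply: CP; [rewrite o0|case/andP: (uM z Kz)].
  have [C C0 CP] := powR_sub_le_lipschitz_pos M r0 e0; exists C => // z Kz ou.
  by apply: CP; rewrite ?o0 ?eu//; case/andP: (uM z Kz).
exists C => // z D Kz D0 uD; have [ou|uo] := leP (o z) (u z).
  by apply: le_trans (CP z Kz ou) _; exact: ler_wpM2l.
apply: (@le_trans _ _ 0); last exact: mulr_ge0.
rewrite subr_le0; apply: ge0_ler_powR => //; rewrite ?nnegrE ?o0 ?(ltW uo)//.
by case/andP: (uM z Kz).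
Qed.

Lemma compact_within_bounded (T : topologicalType) (R : realType) (A : set T)
    (f : T -> R) : compact A -> {within A, continuous f} ->
  exists M, forall z, A z -> `|f z| <= M.
Proof.
move=> cA cf; have [M [_ MP]] := compact_bounded (continuous_compact cf cA).
by exists (M + 1) => z Az; apply: MP; [rewrite ltrDl|exists z].
Qed.

(** Integrates k (u^l - o^l) <= K c over Omega; continuity supplies measurability, and M and K the
    bounds. *)
Lemma boundary_flux_le (R : realType) (n : nat) (Omega : set 'rV[R]_n) (l : R)
    (k : 'rV[R]_n -> 'rV[R]_n -> R -> R) (u o : 'rV[R]_n -> R) (x : 'rV[R]_n)
    (t M K c : R) :
  open Omega -> bounded_set Omega -> 0 <= l -> 0 <= c ->
  {within Omega, continuous u} -> {within Omega, continuous o} ->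
  {within Omega, continuous (fun y => k x y t)} ->
  (forall y, Omega y -> 0 <= u y <= M) -> (forall y, Omega y -> 0 <= o y <= M) ->
  (forall y, Omega y -> 0 <= k x y t <= K) ->
  (forall y, Omega y -> u y `^ l - o y `^ l <= c) ->
  boundary_flux Omega l k u x t <=
    boundary_flux Omega l k o x t + K * c * fine (lebesgue_rV n Omega).
Proof.
move=> oO bO l0 c0 cu co ck uM oM kK uoc.
have mk (v : 'rV[R]_n -> R) : {within Omega, continuous v} ->
    measurable_fun (Omega : set 'rV[measurableTypeR R]_n) (fun y => k x y t * v y `^ l).
  move=> cv; apply: measurable_funM; first exact: open_continuous_measurable_rV.
  apply: (measurableT_comp (measurable_powR l)).
  exact: open_continuous_measurable_rV.
have bk (v : 'rV[R]_n -> R) : (forall y, Omega y -> 0 <= v y <= M) ->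
    forall y, Omega y -> `|k x y t * v y `^ l| <= K * M `^ l.
  move=> vM y Oy; have /andP[k0 kK'] := kK y Oy; have /andP[v0 vM'] := vM y Oy.
  rewrite ger0_norm ?mulr_ge0 ?powR_ge0// ler_pM ?powR_ge0//.
  by apply: ge0_ler_powR; rewrite ?nnegrE// (le_trans v0).
apply: (@le_Rintegral_addcst _ _ _ (lebesgue_rV n) _ _ _ _ (K * M `^ l)).
- exact: measurable_open_rV.
- exact: lebesgue_rV_bounded.
- exact: mk.
- exact: mk.
- exact: bk.
- exact: bk.
- move=> y Oy; have /andP[k0 kK'] := kK y Oy.
  rewrite -lerBlDl -mulrBr; apply: (@le_trans _ _ (k x y t * c)).
    by rewrite ler_wpM2l// uoc.
  by rewrite ler_wpM2r.
Qed.

Lemma time_integral_le (R : realType) (u o : R -> R) (q t M c : R) :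
  0 <= q -> 0 <= t ->
  {within `[0, t], continuous u} -> {within `[0, t], continuous o} ->
  (forall s, 0 <= s <= t -> 0 <= u s <= M) ->
  (forall s, 0 <= s <= t -> 0 <= o s <= M) ->
  (forall s, 0 <= s <= t -> u s `^ q - o s `^ q <= c) ->
  \int[lebesgue_measure]_(s in `[0, t]) (u s `^ q) <=
    \int[lebesgue_measure]_(s in `[0, t]) (o s `^ q) + c * t.
Proof.
move=> q0 t0 cu co uM oM uoc.
have mt : lebesgue_measure (`[0, t]%classic : set R) = t%:E.
  rewrite lebesgue_measure_itv/= lte_fin; case: ltP => [_|t0'].
    by rewrite oppr0 addr0.
  by congr (_%:E); apply/eqP; rewrite eq_le t0.
have mk (v : R -> R) : {within `[0, t], continuous v} ->
    measurable_fun (`[0, t]%classic : set R) (fun y => v y `^ q).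
  move=> cv; apply: (measurableT_comp (measurable_powR q)).
  by apply: subspace_continuous_measurable_fun => //; exact: measurable_itv.
have bk (v : R -> R) : (forall y, 0 <= y <= t -> 0 <= v y <= M) ->
    forall y, `[0, t]%classic y -> `|v y `^ q| <= M `^ q.
  move=> vM y; rewrite /= in_itv/= => yt; have /andP[v0 vM'] := vM y yt.
  rewrite ger0_norm ?powR_ge0//.
  by apply: ge0_ler_powR; rewrite ?nnegrE// (le_trans v0).
have -> : c * t = c * fine (lebesgue_measure (`[0, t]%classic : set R)) by rewrite mt.
apply: (@le_Rintegral_addcst _ _ _ lebesgue_measure _ _ _ _ (M `^ q)).
- exact: measurable_itv.
- by rewrite [X in (X < _)%E](mt : _ = t%:E) ltry.
- exact: mk.
- exact: mk.
- exact: bk.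
- exact: bk.
- by move=> y; rewrite /= in_itv/= => yt; rewrite -lerBlDl; exact: uoc.
Qed.

(** The upper bound is [time_integral_le] against the zero function, with 0^q = 0 because q > 0. *)
Lemma time_integral_bounds (R : realType) (u : R -> R) (q t M : R) :
  0 < q -> 0 <= t -> {within `[0, t], continuous u} ->
  (forall s, 0 <= s <= t -> 0 <= u s <= M) ->
  0 <= \int[lebesgue_measure]_(s in `[0, t]) (u s `^ q) <= M `^ q * t.
Proof.
move=> q0 t0 cu uM; apply/andP; split.
  by apply: Rintegral_ge0 => s _; exact: powR_ge0.
have M0 : 0 <= M.
  have /andP[u0 u0M] : 0 <= u 0 <= M by apply: uM; rewrite lexx.
  exact: le_trans u0M.
have := @time_integral_le R u (fun=> 0) q t M (M `^ q) (ltW q0) t0 cu.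
rewrite powR0 ?gt_eqF// (_ : \int[_]_(_ in _) 0 = 0); last first.
  by rewrite Rintegral_cst ?mul0r.
rewrite add0r; apply.
- by apply: continuous_subspaceT => s; exact: cst_continuous.
- exact: uM.
- by move=> s _; rewrite lexx.
- move=> s st; rewrite subr0; have /andP[u0 u1] := uM s st.
  by apply: ge0_ler_powR; rewrite ?nnegrE ?(ltW q0).
Qed.

(** Subtracts the two differential inequalities at the maximum point. The absorption terms drop out
    by sign, and the reaction difference splits as (up - op) Iu + op (Iu - Io), both parts of order
    D; dividing by D > 0 bounds lam. *)
Lemma growth_rate_le (R : realFieldType)
    (ut ot Lu Lo Iu Io up op um om a b D Cp Cq t Mp Mq L lam : R) :
  ut <= Lu + a * up * Iu - b * um -> Lo + a * op * Io - b * om <= ot ->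
  lam * D <= ut - ot -> Lu <= Lo + L * D -> om <= um -> up - op <= Cp * D ->
  0 <= Iu <= Mq * t -> 0 <= op <= Mp -> Iu <= Io + Cq * D * t ->
  0 < a -> 0 < b -> 0 < D -> 0 <= Cp -> 0 <= Cq -> 0 <= t ->
  lam <= L + a * (Cp * (Mq * t) + Mp * (Cq * t)).
Proof.
move=> uE oE wt wL ou upC /andP[Iu0 IuM] /andP[op0 opM] IuC a0 b0 D0 Cp0 Cq0 t0.
rewrite -(ler_pM2r D0).
have e1 : (up - op) * Iu <= Cp * D * (Mq * t).
  apply: (@le_trans _ _ (Cp * D * Iu)); first exact: ler_wpM2r.
  by rewrite ler_wpM2l// mulr_ge0// ltW.
have e2 : op * (Iu - Io) <= Mp * (Cq * D * t).
  apply: (@le_trans _ _ (op * (Cq * D * t))).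
    by rewrite ler_wpM2l//; lra.
  by rewrite ler_wpM2r// !mulr_ge0// ltW.
have e3 : b * om <= b * um by rewrite ler_pM2l.
have e4 : a * ((up - op) * Iu + op * (Iu - Io)) <=
    a * (Cp * D * (Mq * t) + Mp * (Cq * D * t)) by rewrite ler_pM2l// lerD.
have e5 : a * ((up - op) * Iu + op * (Iu - Io)) = a * up * Iu - a * op * Io by ring.
have -> : (L + a * (Cp * (Mq * t) + Mp * (Cq * t))) * D =
  L * D + a * (Cp * D * (Mq * t) + Mp * (Cq * D * t)) by ring.
by move: e3 e4; rewrite e5; move: uE oE wt wL; clear; lra.
Qed.

(** The initial inequalities hold inside Omega only; this extends them to its closure. A positive
    gap at x would persist at nearby points of Omega, each value moving by at most a third of it. *)
Lemma initial_le (R : realType) (n : nat) (Omega : set 'rV[R]_n)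
    (u o : 'rV[R]_n -> R) :
  {within closure Omega, continuous u} -> {within closure Omega, continuous o} ->
  (forall x, Omega x -> u x <= o x) -> forall x, closure Omega x -> u x <= o x.
Proof.
move=> cu co uo x cx; rewrite leNgt; apply/negP => ou.
have e0 : 0 < (u x - o x) / 3 by lra.
have /within_continuousP/(_ x _ cx e0) ux := cu.
have /within_continuousP/(_ x _ cx e0) ox := co.
have [y [Oy [uy oy]]] := cx _ (filterI ux ox).
have cy := subset_closure Oy; have := uo y Oy.
by move: (uy cy) (oy cy) e0; rewrite !ler_norml; clear; lra.
Qed.

(** * Comparison of subsolutions and supersolutions *)

Unset Implicit Arguments.

Theorem theorem3 (R : realType) (n : nat) (n_ge1 : (1 <= n)%N)
  (Omega : set 'rV[R]_n) (Omega_domain : domain Omega)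
  (Omega_bounded : bounded_set Omega) (Omega_smooth : smooth_boundary Omega)
  (nu : 'rV[R]_n -> 'rV[R]_n)
  (nu_normal : forall x, bdry Omega x -> is_outward_unit_normal Omega x (nu x))
  (p q m l a b : R) (p_ge0 : 0 <= p) (q_gt0 : 0 < q) (m_gt0 : 0 < m)
  (l_gt0 : 0 < l) (a_gt0 : 0 < a) (b_gt0 : 0 < b)
  (k : 'rV[R]_n -> 'rV[R]_n -> R -> R)
  (k_continuous : {within (bdry Omega `*` closure Omega) `*` `[0, +oo[,
     continuous (fun z : 'rV[R]_n * 'rV[R]_n * R => k z.1.1 z.1.2 z.2)})
  (k_ge0 : forall x y t, bdry Omega x -> closure Omega y -> 0 <= t ->
     0 <= k x y t)
  (u0 : 'rV[R]_n -> R) (u0_C1 : C1_closure Omega u0)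
  (u0_ge0 : forall x, Omega x -> 0 <= u0 x)
  (u0_compatible : forall x, bdry Omega x ->
     normal_derivative (nu x) u0 x = boundary_flux Omega l k u0 x 0)
  (T : R) (T_gt0 : 0 < T) (uover uunder : 'rV[R]_n -> R -> R)
  (uover_super : supersolution Omega T nu p q m l a b k u0 uover)
  (uunder_sub : subsolution Omega T nu p q m l a b k u0 uunder)
  (positivity : Num.min q l < 1 \/ 0 < p < 1 ->
     (forall x t, (QT Omega T `|` GammaT Omega T) (x, t) -> 0 < uunder x t) \/
     (forall x t, (QT Omega T `|` GammaT Omega T) (x, t) -> 0 < uover x t)) :
  forall x t, (QT Omega T `|` GammaT Omega T) (x, t) -> uunder x t <= uover x t.
Proof.
have [oO cO nO] := Omega_domain.
have [u0_sub [C21u C10u] ru fu iu] := uunder_sub.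
have [u0_sup [C21o C10o] ro fo io] := uover_super.
have cyl := cylinderP Omega T_gt0.
have T0 : (0 : R) <= 0 < T by rewrite lexx.
have init x : closure Omega x -> uunder x 0 <= uover x 0.
  apply: (@initial_le _ _ Omega (uunder ^~ 0) (uover ^~ 0)).
  - exact: (C10_continuous_slice T_gt0 C10u.1 T0).
  - exact: (C10_continuous_slice T_gt0 C10o.1 T0).
  - by move=> y Oy; apply: le_trans (iu y Oy) (io y Oy).
move=> x1 t1 /cyl[cx1 /andP[]].
rewrite le_eqVlt => /predU1P[<- _|t1_gt0 t1T]; first exact: init.
rewrite leNgt; apply/negP => ou1.
(* Stopping at t1 < T makes the cylinder compact, so that both functions and the kernel are bounded
   up to time t1. *)
pose K := closure Omega `*` `[0, t1].
have KP x t : closure Omega x -> 0 <= t <= t1 -> K (x, t).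
  by move=> cx tt; split=> //=; rewrite in_itv.
have Kc z : K z -> closure Omega z.1 by case.
have Kt z : K z -> 0 <= z.2 <= t1 by move=> [_]; rewrite /= in_itv.
have KT z : K z -> (QT Omega T `|` GammaT Omega T) (z.1, z.2).
  move=> Kz; apply/cyl; split; first exact: Kc.
  by have /andP[-> zt] := Kt z Kz; exact: le_lt_trans t1T.
have cu : {within K, continuous (fun z => uunder z.1 z.2)}.
  exact: (C10_continuous T_gt0 C10u t1T).
have co : {within K, continuous (fun z => uover z.1 z.2)}.
  exact: (C10_continuous T_gt0 C10o t1T).
have compO := compact_closure_bounded Omega_bounded.
have compI : compact (`[0, t1]%classic : set R) by exact: segment_compact.
have compK : compact K by exact: compact_setX.
have [Mu MuP] := compact_within_bounded compK cu.
have [Mo MoP] := compact_within_bounded compK co.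
pose M := Num.max Mu Mo.
have uM z : K z -> 0 <= uunder z.1 z.2 <= M.
  move=> Kz; apply/andP; split; first by apply: u0_sub; exact: KT.
  by rewrite /M le_max (le_trans (ler_norm _) (MuP z Kz)).
have oM z : K z -> 0 <= uover z.1 z.2 <= M.
  move=> Kz; apply/andP; split; first by apply: u0_sup; exact: KT.
  by rewrite /M le_max orbC (le_trans (ler_norm _) (MoP z Kz)).
have [Kk KkP] : exists Kk, forall x y t, bdry Omega x -> closure Omega y ->
    0 <= t <= t1 -> 0 <= k x y t <= Kk.
  have : {within (bdry Omega `*` closure Omega) `*` `[0, t1],
     continuous (fun z : 'rV[R]_n * 'rV[R]_n * R => k z.1.1 z.1.2 z.2)}.
    apply: continuous_subspaceW k_continuous => -[[x y] t] /= [xy].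
    by rewrite !in_itv/= => /andP[-> _].
  move=> /(compact_within_bounded (compact_setX (compact_setX
    (compact_bdry Omega_bounded) compO) compI))[Kk KkP].
  exists Kk => x y t xb cy tt; have /andP[t0 _] := tt.
  rewrite k_ge0//=; apply: le_trans (ler_norm _) _.
  by apply: (KkP (x, y, t)); split; [split|rewrite /= in_itv].
have K1 : K (x1, t1) by apply: KP => //; rewrite lexx ltW.
(* A function positive on the compact K has a positive minimum. If that function is [uover], its
   minimum also bounds [uunder] from below wherever [uover] <= [uunder]. *)
have powers r : 0 <= r -> r = 0 \/ 1 <= r \/ (Num.min q l < 1 \/ 0 < p < 1) ->
    exists2 C, 0 <= C & forall z D, K z -> 0 <= D ->
      uunder z.1 z.2 - uover z.1 z.2 <= D ->
      uunder z.1 z.2 `^ r - uover z.1 z.2 `^ r <= C * D.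
  move=> r0 rP; apply: (power_comparison uM) => [z Kz|].
    by case/andP: (oM z Kz).
  case: rP => [->|[r1|/positivity pos]]; [by left; left|by left; right|right].
  split=> //; case: pos => pos.
    have [z0 z0K z0P] := compact_EVT_min (ex_intro _ _ K1) compK cu.
    exists (uunder z0.1 z0.2); first by apply: pos; apply: KT; exact: set_mem.
    by move=> z Kz _; apply: z0P; rewrite inE.
  have [z0 z0K z0P] := compact_EVT_min (ex_intro _ _ K1) compK co.
  exists (uover z0.1 z0.2); first by apply: pos; apply: KT; exact: set_mem.
  by move=> z Kz; apply: le_trans; apply: z0P; rewrite inE.
have [Cp Cp0 CpP] : exists2 C, 0 <= C & forall z D, K z -> 0 <= D ->
      uunder z.1 z.2 - uover z.1 z.2 <= D ->
      uunder z.1 z.2 `^ p - uover z.1 z.2 `^ p <= C * D.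
  apply: powers => //; have [p1|p1] := leP 1 p; first by right; left.
  have [->|pn0] := eqVneq p 0; first by left.
  by right; right; right; rewrite lt0r pn0 p_ge0.
have [Cq Cq0 CqP] : exists2 C, 0 <= C & forall z D, K z -> 0 <= D ->
      uunder z.1 z.2 - uover z.1 z.2 <= D ->
      uunder z.1 z.2 `^ q - uover z.1 z.2 `^ q <= C * D.
  apply: powers; first exact: ltW.
  have [q1|q1] := leP 1 q; first by right; left.
  by right; right; left; rewrite gt_min q1.
have [Cl Cl0 ClP] : exists2 C, 0 <= C & forall z D, K z -> 0 <= D ->
      uunder z.1 z.2 - uover z.1 z.2 <= D ->
      uunder z.1 z.2 `^ l - uover z.1 z.2 `^ l <= C * D.
  apply: powers; first exact: ltW.
  have [l1|l1] := leP 1 l; first by right; left.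
  by right; right; left; rewrite gt_min l1 orbT.
pose vol := fine (lebesgue_rV n (Omega : set 'rV[measurableTypeR R]_n)).
(* Since phi <= 5/2, c (B - 1) will bound the flux difference when w <= c phi; the 1 makes the
   contradiction strict. *)
pose B := Kk * (Cl * (5 / 2)) * vol + 1.
have [phi [L [cphi phi1 phiO phib]]] :=
  exists_barrier nu_normal B Omega_bounded Omega_smooth.
(* Nonnegativity allows L' <= L' phi, as phi >= 1. *)
pose L' := Num.max L 0.
(* One more than the bound of [growth_rate_le] with t0 replaced by the larger t1. *)
pose lam := L' + a * (Cp * (M `^ q * t1) + M `^ p * (Cq * t1)) + 1.
have lam0 : 0 <= lam.
  have L0 : 0 <= L' by rewrite le_max lexx orbT.
  have s0 : 0 <= Cp * (M `^ q * t1) + M `^ p * (Cq * t1).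
    by rewrite addr_ge0// !mulr_ge0 ?powR_ge0// ltW.
  by rewrite /lam addr_ge0// addr_ge0// mulr_ge0// ltW.
pose psi (z : 'rV[R]_n * R) := expR (lam * z.2) * phi z.1.
have psi0 z : K z -> 0 < psi z.
  by move=> /Kc/phi1/andP[p1 _]; rewrite mulr_gt0 ?expR_gt0// (lt_le_trans _ p1).
pose w z := uunder z.1 z.2 - uover z.1 z.2.
have cF : {within K, continuous (fun z => w z / psi z)}.
  have cphi' : {within K, continuous (fun z => phi z.1)}.
    apply: (@within_continuous_compw _ _ _ _ _ phi fst cphi); last exact: Kc.
    by apply: continuous_subspaceT => z; exact: cvg_fst.
  have ce : {within K, continuous (fun z : 'rV[R]_n * R => expR (lam * z.2))}.
    apply: continuous_subspaceT => z.
    apply: (@continuous_comp _ _ _ (fun z : 'rV[R]_n * R => lam * z.2) expR).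
      by apply: continuousM; [exact: cst_continuous|exact: cvg_snd].
    exact: continuous_expR.
  move: cu co cphi' ce => /subspace_continuousP cu' /subspace_continuousP co'.
  move=> /subspace_continuousP cphi' /subspace_continuousP ce.
  apply/subspace_continuousP => z Kz; apply: cvgM.
    by apply: cvgB; [exact: cu'|exact: co'].
  apply: cvgV; first by rewrite gt_eqF// psi0.
  by apply: cvgM; [exact: ce|exact: cphi'].
have [[x0 t0] /set_mem z0K z0max] := compact_EVT_max (ex_intro _ _ K1) compK cF.
pose mu := w (x0, t0) / psi (x0, t0).
have mu0 : 0 < mu.
  apply: (@lt_le_trans _ _ (w (x1, t1) / psi (x1, t1))); last by apply: z0max; rewrite inE.
  by rewrite divr_gt0 ?psi0// subr_gt0.
have wE : w (x0, t0) = mu * psi (x0, t0) by rewrite divfK// gt_eqF// psi0.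
have w_le z : K z -> w z <= mu * psi z.
  by move=> Kz; rewrite -ler_pdivrMr ?psi0//; apply: z0max; rewrite inE.
have [cx0 /andP[t0_ge0 t0t1]] := conj (Kc _ z0K) (Kt _ z0K).
rewrite /= in cx0 t0_ge0 t0t1.
pose D := mu * psi (x0, t0).
have D0 : 0 < D by rewrite mulr_gt0// psi0.
have t0_gt0 : 0 < t0.
  rewrite lt0r t0_ge0 andbT; apply/negP => /eqP t00; move: D0.
  rewrite /D -wE /w /= t00 subr_gt0 ltNge => /negP; apply; exact: init.
have t0T : 0 < t0 < T by rewrite t0_gt0 (le_lt_trans t0t1).
have t0I : `]0, T[%classic t0 by rewrite /= in_itv.
(* At the fixed time t0 the majorant of w reads c phi. *)
pose c := mu * expR (lam * t0).
have c0 : 0 < c by rewrite mulr_gt0// expR_gt0.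
have DE : D = c * phi x0 by rewrite /D /psi /= mulrA.
have /andP[phi1x phi2x] := phi1 x0 cx0.
have w_le_c y : closure Omega y -> uunder y t0 - uover y t0 <= c * phi y.
  by move=> cy; rewrite /c -mulrA; apply: (w_le (y, t0)); apply: KP => //; exact/andP.
have [Ox0|x0b] := closure_bdry cx0; last first.
  pose E := c * (5 / 2).
  have E0 : 0 <= E by rewrite mulr_ge0// ltW.
  have flux : boundary_flux Omega l k (uunder ^~ t0) x0 t0 <=
      boundary_flux Omega l k (uover ^~ t0) x0 t0 + Kk * (Cl * E) * vol.
    have t0K : 0 <= t0 < T by rewrite t0_ge0; case/andP: t0T.
    have KO y : Omega y -> K (y, t0).
      by move=> /subset_closure cy; apply: KP => //; exact/andP.
    apply: (@boundary_flux_le _ _ _ _ _ _ _ _ _ M) => //.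
    - exact: ltW.
    - exact: mulr_ge0.
    - apply: continuous_subspaceW (C10_continuous_slice T_gt0 C10u.1 t0K).
      exact: subset_closure.
    - apply: continuous_subspaceW (C10_continuous_slice T_gt0 C10o.1 t0K).
      exact: subset_closure.
    - apply: (@within_continuous_compw _ _ _ _ _ _
        (fun y : 'rV[R]_n => ((x0, y), t0)) k_continuous).
        apply: continuous_subspaceT => y A [[U V] /= [[[U1 U2] /= [x0U yU] UU] tV] UV].
        apply: filterS yU => y' Uy'; apply: UV; split; last exact: nbhs_singleton.
        by apply: UU; split=> //; exact: nbhs_singleton.
      by move=> y Oy; split; [split=> //; exact: subset_closure|rewrite /= in_itv/= t0_ge0].
    - by move=> y Oy; apply: (uM (y, t0)); exact: KO.
    - by move=> y Oy; apply: (oM (y, t0)); exact: KO.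
    - by move=> y Oy; apply: KkP => //; [exact: subset_closure|exact/andP].
    - move=> y Oy; apply: (ClP (y, t0)) => //; first exact: KO.
      apply: le_trans (w_le_c y (subset_closure Oy)) _.
      by rewrite ler_pM2l//; case/andP: (phi1 y (subset_closure Oy)).
  have cvu := C10_normal_derivative_cvg oO T_gt0 C10u x0b (nu_normal x0 x0b) t0T.
  have cvo := C10_normal_derivative_cvg oO T_gt0 C10o x0b (nu_normal x0 x0b) t0T.
  have STx : ST Omega T (x0, t0) by [].
  (* As w <= c phi at time t0 with equality at x0, the inward quotients of w dominate those of c
     phi, which are at least c B. *)
  have cB : c * B <= normal_derivative (nu x0) (uunder ^~ t0) x0 -
      normal_derivative (nu x0) (uover ^~ t0) x0.
    have cv : (uunder x0 t0 - uunder (x0 - h *: nu x0) t0) / h -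
        (uover x0 t0 - uover (x0 - h *: nu x0) t0) / h @[h --> (0 : R)^'+] -->
        normal_derivative (nu x0) (uunder ^~ t0) x0 -
        normal_derivative (nu x0) (uover ^~ t0) x0 by exact: cvgB.
    rewrite -(cvg_lim _ cv)//; apply: limr_ge; first by apply/cvg_ex; eexists; exact: cv.
    rewrite near_withinE; have Oh := normal_inward x0b (nu_normal x0 x0b).
    apply: filterS2 Oh (phib x0 x0b) => h Oh ph h0.
    rewrite -mulrBl ler_pdivlMr//.
    have e1 : uunder x0 t0 - uover x0 t0 = c * phi x0 by rewrite -DE /D -wE.
    have e2 := w_le_c _ (subset_closure (Oh h0)).
    have e3 : c * phi (x0 - h *: nu x0) <= c * (phi x0 - B * h).
      by rewrite ler_pM2l//; exact: ph.
    by move: e1 e2 e3; clear; lra.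
  have : c * B <= c * (B - 1).
    have -> : c * (B - 1) = Kk * (Cl * E) * vol by rewrite /B /E; ring.
    by have := fu x0 t0 STx; have := fo x0 t0 STx; move: cB flux; clear; lra.
  by rewrite ler_pM2l//; clear; lra.
have [f [fE fnear f2 fL]] := phiO x0 Ox0.
have QTx : QT Omega T (x0, t0) by [].
(* The smooth f touches phi from above at x0, so w - c f has a local maximum there too. *)
have lap : laplacian (uunder ^~ t0) x0 <= laplacian (uover ^~ t0) x0 + L' * D.
  apply: le_trans (laplacian_le_at_max (c := c)
    (C21_twice_derivable oO C21u Ox0 t0T) (C21_twice_derivable oO C21o Ox0 t0T) f2 _) _.
    apply: filterS2 fnear (open_nbhs_nbhs (conj oO Ox0)) => y fy Oy.
    rewrite fE -DE /D -wE /w /= subrr subr_le0.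
    by apply: le_trans (w_le_c y (subset_closure Oy)) _; rewrite ler_pM2l// fy.
  rewrite lerD2l DE mulrCA ler_pM2l//; apply: (@le_trans _ _ L').
    by rewrite le_max fL.
  by rewrite ler_peMr// le_max lexx orbT.
(* Among s <= t0 the function w - mu psi at x0 is largest at t0, and mu psi has time derivative lam
   D there. *)
have time : lam * D <= derive1 (uunder x0) t0 - derive1 (uover x0) t0.
  have du : is_derive t0 1 (uunder x0) (derive1 (uunder x0) t0).
    by rewrite derive1E; apply: derivableP; case: C21u => _ [+ _] _ _; apply.
  have dov : is_derive t0 1 (uover x0) (derive1 (uover x0) t0).
    by rewrite derive1E; apply: derivableP; case: C21o => _ [+ _] _ _; apply.
  have dlin : is_derive t0 1 (fun s : R => lam * s) (lam * 1).
    by apply: is_deriveZ; exact: is_derive_id.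
  have dexp := @is_derive_compR R _ expR (fun s => lam * s) t0 1 _ _
    (is_derive_expR _) dlin.
  have dh := is_deriveB (is_deriveB du dov) (is_deriveZ (mu * phi x0) dexp).
  have -> : lam * D = (mu * phi x0) *: (expR (lam * t0) * (lam * 1)).
    by rewrite /GRing.scale /= DE /c; ring.
  rewrite -subr_ge0; apply: (derive_ge0_left_max dh).
  near=> s => st0.
  have s0 : 0 < s by near: s; exact: lt_nbhsr.
  have Ks : K (x0, s).
    by apply: KP => //; rewrite (ltW s0) (le_trans (ltW st0)).
  have E r : mu * phi x0 * expR (lam * r) = mu * psi (x0, r).
    by rewrite /psi /= mulrAC mulrA.
  rewrite !fctE /= /GRing.scale /= !E -/(w (x0, s)) -/(w (x0, t0)) wE subrr subr_le0.
  exact: w_le.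
have sub_t s : 0 <= s <= t0 -> K (x0, s).
  by move=> /andP[s0 st]; apply: KP => //; rewrite s0 (le_trans st).
have slice (v : 'rV[R]_n -> R -> R) : {within K, continuous (fun z => v z.1 z.2)} ->
    {within `[0, t0], continuous (v x0)}.
  move=> cv; apply: (@within_continuous_compw _ _ _ _ _ _
    (fun s : R => (x0, s)) cv).
    apply: continuous_subspaceT => s A [[U V] /= [Us Vs] UV].
    by apply: filterS Vs => y Vy; apply: UV; split=> //; exact: nbhs_singleton.
  by move=> s; rewrite /= in_itv/=; exact: sub_t.
have D_ge0 := ltW D0.
have ou0 : uover x0 t0 <= uunder x0 t0.
  by rewrite -subr_ge0 -[leRHS]/(w (x0, t0)) wE ltW.
have Iint := @time_integral_bounds R (uunder x0) q t0 M q_gt0 t0_ge0 (slice _ cu)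
  (fun s st => uM _ (sub_t s st)).
(* As lam >= 0, the majorant increases in time, so w (x0, s) <= D for all s <= t0. *)
have Idiff : \int[lebesgue_measure]_(s in `[0, t0]) (uunder x0 s `^ q) <=
    \int[lebesgue_measure]_(s in `[0, t0]) (uover x0 s `^ q) + Cq * D * t0.
  apply: (time_integral_le (ltW q_gt0) t0_ge0 (slice _ cu) (slice _ co)
    (fun s st => uM _ (sub_t s st)) (fun s st => oM _ (sub_t s st))).
  move=> s st; apply: (CqP (x0, s)) => //; first exact: sub_t.
  apply: le_trans (w_le _ (sub_t s st)) _.
  rewrite ler_pM2l// ler_pM2r ?ler_expR ?ler_wpM2l//; first by case/andP: st.
  exact: lt_le_trans phi1x.
have um_ge : uover x0 t0 `^ m <= uunder x0 t0 `^ m.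
  have /andP[uv0 _] := uM _ z0K; have /andP[ov0 _] := oM _ z0K.
  by apply: ge0_ler_powR; rewrite ?nnegrE// ltW.
have op_le : 0 <= uover x0 t0 `^ p <= M `^ p.
  have /andP[ov0 oM0] := oM _ z0K; rewrite powR_ge0/=.
  by apply: ge0_ler_powR; rewrite ?nnegrE//; exact: le_trans oM0.
have rate := growth_rate_le (ru x0 t0 QTx) (ro x0 t0 QTx) time lap um_ge
  (CpP _ _ z0K D_ge0 (w_le _ z0K)) Iint op_le Idiff a_gt0 b_gt0 D0 Cp0 Cq0 t0_ge0.
have : L' + a * (Cp * (M `^ q * t0) + M `^ p * (Cq * t0)) <= lam - 1.
  rewrite /lam addrK lerD2l ler_pM2l// lerD//.
    by rewrite ler_wpM2l// ler_wpM2l ?powR_ge0.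
  by rewrite ler_wpM2l ?powR_ge0// ler_wpM2l.
by move: rate; clear; lra.
Unshelve. all: by end_near. Qed.
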